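(* Let $m\ge 2$. If $H$ is a finite dimensional hereditary algebra over a field $k$, then $\mathbf{C}_{\equiv m}(\operatorname{proj}H)$ is a left Auslander-Reiten category. Conversely, for a finite dimensional $k$-algebra $H$, if $\mathbf{C}_{\equiv m}(\operatorname{proj}H)$ is a left Auslander-Reiten category for $m>2$, then $H$ is a hereditary algebra.
   Context: $\operatorname{proj}H$ is the category of finitely generated projective $H$-modules. $\mathbf{C}_{\equiv m}(\operatorname{proj}H)$ is the category of $m$-periodic complexes: complexes $X=(X^i,d_X^i)_{i\in\mathbb{Z}}$ over $\operatorname{proj}H$ with $X^i=X^j$, $d_X^i=d_X^j$ whenever $i\equiv j\pmod m$; morphisms are chain maps $(f^i)$ with $f^i=f^j$ whenever $i\equiv j\pmod m$. It carries the exact structure whose conflations are split exact in each degree. In a Krull-Schmidt category, a sink morphism is a minimal right almost split morphism. An object $X$ is pseudo-projective if there is a sink monomorphism $M\to X$. An almost split sequence is a conflation $X\xrightarrow{f}Y\xrightarrow{g}Z$ with $f$ minimal left almost split and $g$ minimal right almost split. A Krull-Schmidt category is a left Auslander-Reiten category if each indecomposable object is either pseudo-projective or the end term of an almost split sequence. *)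

(* Defs.v *)
From HB Require Import structures.
From mathcomp Require Import all_boot all_algebra all_field.
From mathcomp Require Import boolp.

Set Implicit Arguments.
Unset Strict Implicit.
Unset Printing Implicit Defensive.

Import GRing.Theory.
Local Open Scope ring_scope.

Declare Scope cat_scope.
Delimit Scope cat_scope with cat.
Local Open Scope cat_scope.

Record preadditive := Preadditive {
  obj :> Type;
  hom : obj -> obj -> zmodType;
  idm : forall X, hom X X;
  ccomp : forall X Y Z, hom Y Z -> hom X Y -> hom X Z
    where "g \o f" := (ccomp g f) : cat_scope;
  ccompA : forall W X Y Z (h : hom Y Z) (g : hom X Y) (f : hom W X),
    h \o (g \o f) = (h \o g) \o f;
  ccomp1m : forall X Y (f : hom X Y), idm Y \o f = f;
  ccompm1 : forall X Y (f : hom X Y), f \o idm X = f;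
  ccompDl : forall X Y Z (g g' : hom Y Z) (f : hom X Y),
    (g + g') \o f = (g \o f) + (g' \o f);
  ccompDr : forall X Y Z (g : hom Y Z) (f f' : hom X Y),
    g \o (f + f') = (g \o f) + (g \o f')
}.

Arguments idm {p} X.
Arguments ccomp {p X Y Z} g f.
Notation "g \o f" := (ccomp g f) : cat_scope.

Section Preadditive.
Variable C : preadditive.

Definition is_iso (X Y : C) (f : hom X Y) :=
  exists g : hom Y X, g \o f = idm X /\ f \o g = idm Y.

Definition mono (X Y : C) (f : hom X Y) :=
  forall (W : C) (u v : hom W X), f \o u = f \o v -> u = v.

Definition split_mono (X Y : C) (f : hom X Y) :=
  exists r : hom Y X, r \o f = idm X.

Definition split_epi (X Y : C) (f : hom X Y) :=
  exists s : hom Y X, f \o s = idm Y.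

(* In a preadditive category, X is initial iff it is terminal iff its         *)
(* identity vanishes.                                                         *)
Definition zero_object (X : C) := idm X = 0.

(* X --f--> Y --g--> Z is isomorphic to X -> X (+) Z -> Z *)
Definition split_exact (X Y Z : C) (f : hom X Y) (g : hom Y Z) :=
  exists (r : hom Y X) (s : hom Z Y),
    [/\ r \o f = idm X, g \o s = idm Z, g \o f = 0, r \o s = 0 &
        (f \o r) + (s \o g) = idm Y].

Definition direct_sum2 (X A B : C) :=
  exists (f : hom A X) (g : hom X B), split_exact f g.

Definition direct_sum (n : nat) (A : 'I_n -> C) (X : C) :=
  exists (u : forall i, hom (A i) X) (p : forall i, hom X (A i)),
    [/\ forall i, p i \o u i = idm (A i),
        forall i j, i != j -> p i \o u j = 0 &
        \sum_i (u i \o p i) = idm X].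

Definition additive_category :=
  forall (n : nat) (A : 'I_n -> C), exists X, direct_sum A X.

Definition indecomposable (X : C) :=
  ~ zero_object X /\
  forall A B, direct_sum2 X A B -> zero_object A \/ zero_object B.

(* The endomorphism ring of X is nonzero and its non-units are closed under   *)
(* addition.                                                                  *)
Definition local_endo (X : C) :=
  ~ zero_object X /\
  forall f g : hom X X, ~ is_iso f -> ~ is_iso g -> ~ is_iso (f + g).

Definition krull_schmidt :=
  additive_category /\
  forall X, exists n (A : 'I_n -> C),
    direct_sum A X /\ forall i, local_endo (A i).

Definition right_minimal (X Y : C) (g : hom X Y) :=
  forall h : hom X X, g \o h = g -> is_iso h.

Definition left_minimal (X Y : C) (f : hom X Y) :=
  forall h : hom Y Y, h \o f = f -> is_iso h.

Definition right_almost_split (Y Z : C) (g : hom Y Z) :=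
  ~ split_epi g /\
  forall (W : C) (h : hom W Z), ~ split_epi h ->
    exists h' : hom W Y, g \o h' = h.

Definition left_almost_split (X Y : C) (f : hom X Y) :=
  ~ split_mono f /\
  forall (W : C) (h : hom X W), ~ split_mono h ->
    exists h' : hom Y W, h' \o f = h.

Definition sink (Y Z : C) (g : hom Y Z) :=
  right_minimal g /\ right_almost_split g.

Definition source (X Y : C) (f : hom X Y) :=
  left_minimal f /\ left_almost_split f.

Definition pseudo_projective (X : C) :=
  exists (M : C) (f : hom M X), sink f /\ mono f.

(* An exact structure enters only through its class of conflations. *)
Variable conflation : forall X Y Z : C, hom X Y -> hom Y Z -> Prop.

Definition almost_split_sequence (X Y Z : C) (f : hom X Y) (g : hom Y Z) :=
  [/\ conflation f g, source f & sink g].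

Definition left_AR_category :=
  krull_schmidt /\
  forall Z, indecomposable Z ->
    pseudo_projective Z \/
    exists (X Y : C) (f : hom X Y) (g : hom Y Z), almost_split_sequence f g.

End Preadditive.

Arguments left_AR_category C conflation : clear implicits.

Section Periodic.
Variables (A : preadditive) (m : nat).

(* A family over int that depends only on the index modulo m is a family over *)
(* 'I_m; ordS is the cyclic successor i |-> i + 1 mod m.                      *)
Record pcomplex := PComplex {
  pc_obj :> 'I_m -> A;
  pc_d : forall i, hom (pc_obj i) (pc_obj (ordS i));
  pc_dd : forall i, pc_d (ordS i) \o pc_d i = 0
}.

Record chain_map (X Y : pcomplex) := ChainMap {
  cm_fun :> forall i, hom (X i) (Y i);
  cm_comm : forall i, cm_fun (ordS i) \o pc_d X i = pc_d Y i \o cm_fun i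
}.

Lemma chain_map_ext (X Y : pcomplex) (f g : chain_map X Y) :
  (forall i, f i = g i) -> f = g.
Proof.
case: f g => [f cf] [g cg] /= fg.
have {}fg : f = g by exact: functional_extensionality_dep.
by subst g; congr ChainMap; exact: Prop_irrelevance.
Qed.

Lemma ccomp0m (X Y Z : A) (f : hom X Y) : (0 : hom Y Z) \o f = 0.
Proof. by apply: (addrI ((0 : hom Y Z) \o f)); rewrite -ccompDl !addr0. Qed.

Lemma ccompm0 (X Y Z : A) (g : hom Y Z) : g \o (0 : hom X Y) = 0.
Proof. by apply: (addrI (g \o (0 : hom X Y))); rewrite -ccompDr !addr0. Qed.

Lemma ccompNm (X Y Z : A) (g : hom Y Z) (f : hom X Y) : (- g) \o f = - (g \o f).
Proof. by apply/eqP; rewrite -addr_eq0 -ccompDl addNr ccomp0m. Qed.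

Lemma ccompmN (X Y Z : A) (g : hom Y Z) (f : hom X Y) : g \o (- f) = - (g \o f).
Proof. by apply/eqP; rewrite -addr_eq0 -ccompDr addNr ccompm0. Qed.

Section ChainMapZmod.
Variables X Y : pcomplex.
Implicit Types f g : chain_map X Y.

Lemma cm_zero_comm (i : 'I_m) :
  (0 : hom (X (ordS i)) (Y (ordS i))) \o pc_d X i = pc_d Y i \o 0.
Proof. by rewrite ccomp0m ccompm0. Qed.

Definition cm_zero : chain_map X Y := ChainMap cm_zero_comm.

Lemma cm_opp_comm f (i : 'I_m) :
  (- f (ordS i)) \o pc_d X i = pc_d Y i \o (- f i).
Proof. by rewrite ccompNm ccompmN cm_comm. Qed.

Definition cm_opp f : chain_map X Y := ChainMap (cm_opp_comm f).

Lemma cm_add_comm f g (i : 'I_m) :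
  (f (ordS i) + g (ordS i)) \o pc_d X i = pc_d Y i \o (f i + g i).
Proof. by rewrite ccompDl ccompDr !cm_comm. Qed.

Definition cm_add f g : chain_map X Y := ChainMap (cm_add_comm f g).

Lemma cm_addA : associative cm_add.
Proof. by move=> f g h; apply: chain_map_ext => i /=; rewrite addrA. Qed.

Lemma cm_addC : commutative cm_add.
Proof. by move=> f g; apply: chain_map_ext => i /=; rewrite addrC. Qed.

Lemma cm_add0 : left_id cm_zero cm_add.
Proof. by move=> f; apply: chain_map_ext => i /=; rewrite add0r. Qed.

Lemma cm_addN : left_inverse cm_zero cm_opp cm_add.
Proof. by move=> f; apply: chain_map_ext => i /=; rewrite addNr. Qed.

HB.instance Definition _ := gen_eqMixin (chain_map X Y).
HB.instance Definition _ := gen_choiceMixin (chain_map X Y).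
HB.instance Definition _ :=
  GRing.isZmodule.Build (chain_map X Y) cm_addA cm_addC cm_add0 cm_addN.

End ChainMapZmod.

Lemma cm_id_comm (X : pcomplex) (i : 'I_m) :
  idm (X (ordS i)) \o pc_d X i = pc_d X i \o idm (X i).
Proof. by rewrite ccomp1m ccompm1. Qed.

Definition cm_id X : chain_map X X := ChainMap (cm_id_comm X).

Lemma cm_comp_comm X Y Z (g : chain_map Y Z) (f : chain_map X Y) (i : 'I_m) :
  (g (ordS i) \o f (ordS i)) \o pc_d X i = pc_d Z i \o (g i \o f i).
Proof. by rewrite -ccompA cm_comm ccompA cm_comm -ccompA. Qed.

Definition cm_comp X Y Z (g : chain_map Y Z) (f : chain_map X Y) :
  chain_map X Z := ChainMap (cm_comp_comm g f).

Lemma cm_compA W X Y Z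
    (h : chain_map Y Z) (g : chain_map X Y) (f : chain_map W X) :
  cm_comp h (cm_comp g f) = cm_comp (cm_comp h g) f.
Proof. by apply: chain_map_ext => i /=; rewrite ccompA. Qed.

Lemma cm_comp1m X Y (f : chain_map X Y) : cm_comp (cm_id Y) f = f.
Proof. by apply: chain_map_ext => i /=; rewrite ccomp1m. Qed.

Lemma cm_compm1 X Y (f : chain_map X Y) : cm_comp f (cm_id X) = f.
Proof. by apply: chain_map_ext => i /=; rewrite ccompm1. Qed.

Lemma cm_compDl X Y Z (g g' : chain_map Y Z) (f : chain_map X Y) :
  cm_comp (g + g') f = cm_comp g f + cm_comp g' f.
Proof. by apply: chain_map_ext => i /=; rewrite ccompDl. Qed.

Lemma cm_compDr X Y Z (g : chain_map Y Z) (f f' : chain_map X Y) :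
  cm_comp g (f + f') = cm_comp g f + cm_comp g f'.
Proof. by apply: chain_map_ext => i /=; rewrite ccompDr. Qed.

Definition periodic_complexes : preadditive :=
  @Preadditive pcomplex (fun X Y => chain_map X Y) cm_id cm_comp
    cm_compA cm_comp1m cm_compm1 cm_compDl cm_compDr.

Definition degreewise_split (X Y Z : periodic_complexes)
    (f : hom X Y) (g : hom Y Z) :=
  forall i : 'I_m, split_exact (cm_fun f i) (cm_fun g i).

End Periodic.

Section Modules.
Variable R : nzRingType.

Definition finitely_generated (P : lmodType R) :=
  exists n (e : 'I_n -> P), forall x, exists c : 'I_n -> R,
    x = \sum_i c i *: e i.

Definition projective (P : lmodType R) :=
  forall (M N : lmodType R) (p : {linear M -> N}) (f : {linear P -> N}),
    (forall y, exists x, p x = y) ->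
    exists g : {linear P -> M}, forall x, p (g x) = f x.

Record submodule (V : lmodType R) (S : submodClosed V) := Submodule {
  submodule_val :> V;
  submodule_valP : submodule_val \in S
}.

Section SubmoduleInstances.
Variables (V : lmodType R) (S : submodClosed V).
HB.instance Definition _ := [isSub for @submodule_val V S].
HB.instance Definition _ := [Choice of submodule S by <:].
HB.instance Definition _ := [SubChoice_isSubLmodule of submodule S by <:].
End SubmoduleInstances.

(* The submodules of the regular module R^o are the left ideals of R. Modules *)
(* are left modules throughout, so this is left hereditary; the left and      *)
(* right notions agree for finite dimensional algebras.                       *)
Definition hereditary :=
  forall I : submodClosed R^o, projective (submodule I).

Definition linear_map (P Q : lmodType R) := {linear P -> Q}.

Lemma linear_map_ext (P Q : lmodType R) (f g : linear_map P Q) :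
  f =1 g -> f = g.
Proof.
case: f g => [f [[a] [b]]] [g [[c] [d]]] /= fg.
have {}fg : f = g by exact: funext.
by subst g; rewrite (Prop_irrelevance a c) (Prop_irrelevance b d).
Qed.

Section LinearMapZmod.
Variables P Q : lmodType R.
Implicit Types f g : linear_map P Q.

Definition lm_zero : linear_map P Q := \0.
Definition lm_opp f : linear_map P Q := \- f.
Definition lm_add f g : linear_map P Q := f \+ g.

Lemma lm_addA : associative lm_add.
Proof. by move=> f g h; apply: linear_map_ext => x /=; rewrite addrA. Qed.

Lemma lm_addC : commutative lm_add.
Proof. by move=> f g; apply: linear_map_ext => x /=; rewrite addrC. Qed.

Lemma lm_add0 : left_id lm_zero lm_add.
Proof. by move=> f; apply: linear_map_ext => x /=; rewrite add0r. Qed.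

Lemma lm_addN : left_inverse lm_zero lm_opp lm_add.
Proof. by move=> f; apply: linear_map_ext => x /=; rewrite addNr. Qed.

HB.instance Definition _ := gen_eqMixin (linear_map P Q).
HB.instance Definition _ := gen_choiceMixin (linear_map P Q).
HB.instance Definition _ :=
  GRing.isZmodule.Build (linear_map P Q) lm_addA lm_addC lm_add0 lm_addN.

End LinearMapZmod.

Definition lm_id (P : lmodType R) : linear_map P P := idfun.

Definition lm_comp (P Q S : lmodType R)
    (g : linear_map Q S) (f : linear_map P Q) : linear_map P S :=
  (g \o f)%FUN.

Record fg_projective := FgProjective {
  fgp_module :> lmodType R;
  fgp_finitely_generated : finitely_generated fgp_module;
  fgp_projective : projective fgp_module
}.

Implicit Types P Q S T : fg_projective.

Lemma lm_compA P Q S T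
    (h : linear_map S T) (g : linear_map Q S) (f : linear_map P Q) :
  lm_comp h (lm_comp g f) = lm_comp (lm_comp h g) f.
Proof. exact: linear_map_ext. Qed.

Lemma lm_comp1m P Q (f : linear_map P Q) : lm_comp (lm_id Q) f = f.
Proof. exact: linear_map_ext. Qed.

Lemma lm_compm1 P Q (f : linear_map P Q) : lm_comp f (lm_id P) = f.
Proof. exact: linear_map_ext. Qed.

Lemma lm_compDl P Q S (g g' : linear_map Q S) (f : linear_map P Q) :
  lm_comp (g + g') f = lm_comp g f + lm_comp g' f.
Proof. exact: linear_map_ext. Qed.

Lemma lm_compDr P Q S (g : linear_map Q S) (f f' : linear_map P Q) :
  lm_comp g (f + f') = lm_comp g f + lm_comp g f'.
Proof. by apply: linear_map_ext => x /=; rewrite linearD. Qed.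

Definition proj : preadditive :=
  @Preadditive fg_projective (fun P Q => linear_map P Q)
    (fun P => lm_id P) (fun P Q S => @lm_comp P Q S)
    lm_compA lm_comp1m lm_compm1 lm_compDl lm_compDr.

End Modules.

(* Main.v *)
From HB Require Import structures.
From mathcomp Require Import all_boot all_algebra all_field.
From mathcomp Require Import boolp.
Require Import Defs.

Set Implicit Arguments.
Unset Strict Implicit.
Unset Printing Implicit Defensive.

Import GRing.Theory.
Local Open Scope ring_scope.
Local Open Scope cat_scope.

(** Fix a finite dimensional algebra [H] over [k] and write [C] for the category
  of [m]-periodic complexes over [proj H], whose conflations are the degreewise
  split sequences.

  _Krull-Schmidt property._ Endomorphisms of a complex form a finite dimensional
  space, so the powers of an endomorphism are linearly dependent and Fitting's
  lemma holds. As idempotents split in [C], objects without nontrivial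
  idempotents have local endomorphism rings, and a dimension count decomposes
  every object into such ones ([krull_schmidt_of_dimension]). Fitting's lemma
  also turns a right almost split morphism into a sink
  ([sink_of_right_almost_split]), and the kernel of a degreewise surjective sink
  is a source ([source_of_sink]). It remains to find, for each indecomposable
  [Z], a right almost split morphism to [Z] that is a monomorphism or is
  degreewise surjective.

  _Hereditary algebras, [Z] contractible._ The images of the maps to [Z] that are
  not split epimorphisms form a proper subcomplex, whose degrees are submodules
  of projectives and hence projective; its inclusion is a sink
  ([pseudo_projective_of_contractible]).

  _Hereditary algebras, [Z] not contractible._ A functional [f] on the linear
  endomorphisms of the total module [tot Z] that vanishes on null-homotopic and
  on non-invertible chain maps, but not on the identity, corresponds under
  [D Hom(P, W) = Hom(W, D Hom(P, H))], for [P = tot Z], to a chain map [theta]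
  from [Z] to its Nakayama dual. By the same duality, [theta h] is null-homotopic
  for each [h] that is not a split epimorphism, while [theta] itself is not. So
  the cocone of [theta] maps to [Z] in a right almost split way, except that its
  terms are not projective. Over a hereditary algebra a complex [E] of modules
  with a free cover [p : F -> E] in each degree can be replaced by the complex of
  the pairs [(y, x)] in [F^i * F^(i+1)] with [p x = d (p y)] and differential
  [(y, x) |-> (x, 0)]: a map [W -> E] with projective terms lifts to it, by
  choosing a lift [e] of the map in each degree and taking [(e, e d)]
  ([right_almost_split_ex]).

  _The converse._ For an indecomposable projective [P] the disk [P = P] is
  projective in the exact structure, so no almost split sequence ends in it, and
  it is pseudo-projective. Testing the sink monomorphism against maps from disks
  shows that it is, in the first nonzero degree, the inclusion of the radical of
  [P], which is therefore projective ([disk_radical]). A maximal submodule [L] of a projective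
  [Q] is then projective, because [L] is the sum of [Q / P] and the radical of [P]
  for a suitable indecomposable summand [P] of [Q]
  ([maximal_submodule_projective]), and one descends from [H] to any left ideal
  ([left_ideal_projective]). *)

(** * Krull-Schmidt categories and almost split sequences *)

Section Abstract.
Variable C : preadditive.
Implicit Types W X Y Z : C.

Lemma ccompBl X Y Z (g g' : hom Y Z) (f : hom X Y) :
  (g - g') \o f = (g \o f) - (g' \o f).
Proof. by rewrite ccompDl ccompNm. Qed.

Lemma ccompBr X Y Z (g : hom Y Z) (f f' : hom X Y) :
  g \o (f - f') = (g \o f) - (g \o f').
Proof. by rewrite ccompDr ccompmN. Qed.

Lemma ccomp_suml (I : finType) X Y Z (g : I -> hom Y Z) (f : hom X Y) :
  (\sum_i g i) \o f = \sum_i (g i \o f).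
Proof.
by elim/big_rec2: _ => [|i _ z _ <-]; rewrite ?ccomp0m // ccompDl.
Qed.

Lemma ccomp_sumr (I : finType) X Y Z (g : hom Y Z) (f : I -> hom X Y) :
  g \o (\sum_i f i) = \sum_i (g \o f i).
Proof.
by elim/big_rec2: _ => [|i _ z _ <-]; rewrite ?ccompm0 // ccompDr.
Qed.

Lemma iso_comp X Y Z (g : hom Y Z) (f : hom X Y) :
  is_iso g -> is_iso f -> is_iso (g \o f).
Proof.
move=> [g' [g'g gg']] [f' [f'f ff']]; exists (f' \o g'); split.
  by rewrite -ccompA (ccompA g') g'g ccomp1m.
by rewrite -ccompA (ccompA f) ff' ccomp1m.
Qed.

Lemma iso_cancell X Y (g : hom X Y) (g' : hom Y X) (f : hom X X) :
  g' \o g = idm X -> g \o g' = idm Y -> is_iso (g \o f) -> is_iso f.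
Proof.
move=> g'g gg' gf_iso.
have -> : f = g' \o (g \o f) by rewrite ccompA g'g ccomp1m.
by apply: iso_comp => //; exists g.
Qed.

Lemma non_split_epi_comp W Z (h : hom W Z) (u : hom Z W) :
  ~ split_epi h -> ~ is_iso (h \o u).
Proof. by move=> hN [v [_ huv]]; apply: hN; exists (u \o v); rewrite ccompA. Qed.

Fixpoint hpow X (h : hom X X) n : hom X X :=
  if n is n'.+1 then h \o hpow h n' else idm X.

Lemma hpow_comm X (h q : hom X X) n :
  q \o h = h \o q -> q \o hpow h n = hpow h n \o q.
Proof.
move=> qh; elim: n => [|n IHn] /=; first by rewrite ccomp1m ccompm1.
by rewrite ccompA qh -ccompA IHn ccompA.
Qed.

Lemma hpowD X (h : hom X X) a b : hpow h (a + b) = hpow h a \o hpow h b.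
Proof.
by elim: a => [|a IHa]; rewrite ?ccomp1m // addSn /= IHa ccompA.
Qed.

(** Strong pi-regularity, the ring-theoretic form of the statement that the images
  of the powers of [h] become stationary. *)
Definition stabilizes X (h : hom X X) :=
  exists r q, q \o h = h \o q /\ hpow h r = hpow h r.+1 \o q.

(** Fitting's lemma: [e] is the projection onto the stable image of [h] along
  the stable kernel. *)
Lemma fitting X (h : hom X X) : stabilizes h ->
  exists e n t, [/\ e \o e = e, hpow h n \o e = hpow h n,
    e = hpow h n \o t & e = idm X -> is_iso h].
Proof.
move=> [r [q [qh hr]]].
have hrS : hpow h r.+1 = hpow h r.+2 \o q by rewrite /= {1}hr /= !ccompA.
set n := r.+1 in hrS.
have absorb j : hpow h n = hpow h (n + j) \o hpow q j.
  elim: j => [|j IHj]; first by rewrite addn0 ccompm1.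
  rewrite {1}IHj addnS -[RHS]/(_ \o (q \o hpow q j)) (ccompA _ q).
  by congr (_ \o _); rewrite addnC hpowD hrS ccompA -hpowD addnS.
have qp j : hpow q j \o hpow h n = hpow h n \o hpow q j.
  by apply/esym/hpow_comm/esym/hpow_comm.
exists (hpow h n \o hpow q n), n, (hpow q n).
have pp : hpow h n = hpow h n \o (hpow h n \o hpow q n).
  by rewrite ccompA -hpowD -absorb.
have e_idem : (hpow h n \o hpow q n) \o (hpow h n \o hpow q n)
    = hpow h n \o hpow q n.
  by rewrite ccompA -(ccompA (hpow h n)) qp -pp.
split; [exact: e_idem | exact: esym pp | by [] | move=> e1].
exists (hpow h r \o hpow q n); split; last by rewrite ccompA.
have hq_n : h \o hpow q n = hpow q n \o h by apply: hpow_comm.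
have hh_r : h \o hpow h r = hpow h r \o h by apply: hpow_comm.
by rewrite -[RHS]e1 -ccompA -hq_n (ccompA (hpow h r)) -hh_r.
Qed.

Lemma one_sub_nilpotent X (h : hom X X) n :
  hpow h n = 0 -> is_iso (idm X - h).
Proof.
move=> hn0.
have [s [hs sE]] : exists s, s \o h = h \o s
    /\ (idm X - h) \o s = idm X - hpow h n.
  elim: n {hn0} => [|n [s [hs sE]]].
    by exists 0; rewrite ccomp0m !ccompm0 subrr.
  exists (idm X + (h \o s)); split.
    by rewrite ccompDl ccompDr ccomp1m ccompm1 -ccompA hs.
  rewrite ccompDr ccompm1 ccompA.
  have -> : (idm X - h) \o h = h \o (idm X - h).
    by rewrite ccompBl ccompBr ccomp1m ccompm1.
  by rewrite -ccompA sE ccompBr ccompm1 addrA subrK.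
exists s; split; last by rewrite sE hn0 subr0.
by rewrite ccompBr hs ccompm1 -{1}(ccomp1m s) -ccompBl sE hn0 subr0.
Qed.

(** When every endomorphism obeys Fitting's lemma and no idempotent is
  nontrivial, each endomorphism is invertible or nilpotent. *)
Lemma local_endo_of_idempotents X :
  (forall h : hom X X, stabilizes h) -> ~ zero_object X ->
  (forall e : hom X X, e \o e = e -> e = 0 \/ e = idm X) -> local_endo X.
Proof.
move=> stabX X0 idemX; split=> // f g fN gN [u [ufg fgu]].
have nil_or_iso (h : hom X X) : is_iso h \/ exists n, hpow h n = 0.
  have [e [n [t [ee hne eE eiso]]]] := fitting (stabX h).
  case: (idemX e ee) => [e0|e1]; last by left; apply: eiso.
  by right; exists n; rewrite -hne e0 ccompm0.
have cancel (w : hom X X) : is_iso (u \o w) -> is_iso w by exact: iso_cancell fgu ufg.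
have [/cancel // | [n ufn]] := nil_or_iso (u \o f).
apply: gN; apply: cancel.
have -> : u \o g = idm X - (u \o f) by rewrite -ufg ccompDr addrC addrA addNr add0r.
exact: one_sub_nilpotent ufn.
Qed.

Definition idempotents_split :=
  forall X (e : hom X X), e \o e = e ->
    exists A (i : hom A X) (r : hom X A), r \o i = idm A /\ i \o r = e.

Lemma idempotent_compl X (e : hom X X) :
  e \o e = e -> (idm X - e) \o (idm X - e) = idm X - e.
Proof.
by move=> ee; rewrite ccompBl ccomp1m ccompBr ccompm1 ee subrr subr0.
Qed.

Lemma split_idempotent2 X (e : hom X X) : idempotents_split -> e \o e = e ->
  exists A B (i : hom A X) (r : hom X A) (j : hom B X) (q : hom X B),
    [/\ r \o i = idm A, q \o j = idm B, q \o i = 0, r \o j = 0 &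
        i \o r = e /\ j \o q = idm X - e].
Proof.
move=> splitC ee.
have [A [i [r [ri ir]]]] := splitC _ _ ee.
have [B [j [q [qj jq]]]] := splitC _ _ (idempotent_compl ee).
have ei : e \o i = i by rewrite -ir -ccompA ri ccompm1.
have re : r \o e = r by rewrite -ir ccompA ri ccomp1m.
have qj1 : q \o (idm X - e) = q by rewrite -jq ccompA qj ccomp1m.
have j1 : (idm X - e) \o j = j by rewrite -jq -ccompA qj ccompm1.
exists A, B, i, r, j, q; split=> //.
- by rewrite -qj1 -ccompA ccompBl ccomp1m ei subrr ccompm0.
- by rewrite -j1 ccompA ccompBr ccompm1 re subrr ccomp0m.
Qed.

Lemma indecomposable_idempotent X (e : hom X X) :
  idempotents_split -> indecomposable X -> e \o e = e -> e = 0 \/ e = idm X.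
Proof.
move=> splitC [_ decX] ee.
have [A [B [i [r [j [q [ri qj qi rj [ir jq]]]]]]]] :=
  split_idempotent2 splitC ee.
have : direct_sum2 X A B.
  exists i, q, r, j; split=> //; first by rewrite ir jq addrC subrK.
case/decX=> [A0|B0]; [left|right].
  by rewrite -ir -(ccompm1 i) A0 ccompm0 ccomp0m.
apply/esym/eqP; rewrite -subr_eq0; apply/eqP.
by rewrite -jq -(ccompm1 j) B0 ccompm0 ccomp0m.
Qed.

(** ** Krull-Schmidt decompositions *)

Lemma direct_sum_cat X A B (i : hom A X) (r : hom X A) (j : hom B X)
    (q : hom X B) n1 n2 (F1 : 'I_n1 -> C) (F2 : 'I_n2 -> C) :
  r \o i = idm A -> q \o j = idm B -> q \o i = 0 -> r \o j = 0 ->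
  (i \o r) + (j \o q) = idm X -> direct_sum F1 A -> direct_sum F2 B ->
  direct_sum (fun x : 'I_(n1 + n2) =>
    match split x with inl a => F1 a | inr b => F2 b end) X.
Proof.
move=> ri qj qi rj ijX [u1 [p1 [pu1 pu1N up1]]] [u2 [p2 [pu2 pu2N up2]]].
pose F (s : 'I_n1 + 'I_n2) := match s with inl a => F1 a | inr b => F2 b end.
pose u (s : 'I_n1 + 'I_n2) : hom (F s) X :=
  match s with inl a => i \o u1 a | inr b => j \o u2 b end.
pose p (s : 'I_n1 + 'I_n2) : hom X (F s) :=
  match s with inl a => p1 a \o r | inr b => p2 b \o q end.
have mid Y Z Y' Z' (a : hom Y Z) (b : hom X Y) (c : hom Y' X) (d : hom Z' Y') :
  (a \o b) \o (c \o d) = a \o ((b \o c) \o d) by rewrite !ccompA.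
exists (fun x => u (split x)), (fun x => p (split x)); split.
- move=> x; case: (split x) => [a|b] /=.
    by rewrite mid ri ccomp1m pu1.
  by rewrite mid qj ccomp1m pu2.
- move=> x y xy.
  have {xy} : split x <> split y.
    by move=> /(congr1 unsplit); rewrite !splitK => /eqP; rewrite (negbTE xy).
  case: (split x) (split y) => [a|b] [a'|b'] /= ab; rewrite mid.
  + by rewrite ri ccomp1m pu1N //; apply/eqP=> aE; apply: ab; rewrite aE.
  + by rewrite rj ccomp0m ccompm0.
  + by rewrite qi ccomp0m ccompm0.
  + by rewrite qj ccomp1m pu2N //; apply/eqP=> aE; apply: ab; rewrite aE.
- rewrite big_split_ord /= -ijX; congr (_ + _).
    transitivity (\sum_a (i \o ((u1 a \o p1 a) \o r))).
      by apply: eq_bigr => a _; rewrite (unsplitK (inl a)) /= !ccompA.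
    by rewrite -ccomp_sumr -ccomp_suml up1 ccomp1m.
  transitivity (\sum_b (j \o ((u2 b \o p2 b) \o q))).
    by apply: eq_bigr => b _; rewrite (unsplitK (inr b)) /= !ccompA.
  by rewrite -ccomp_sumr -ccomp_suml up2 ccomp1m.
Qed.

Section Dimension.
Variable dim : C -> nat -> Prop.

(** [dim X n] stands for a bound on the size of [X]; the only thing that matters
  is that a proper retract admits a strictly smaller bound. *)
Definition drops_on_retracts :=
  forall X A (i : hom A X) (r : hom X A) n,
    r \o i = idm A -> i \o r <> idm X -> dim X n ->
    exists2 n', (n' < n)%N & dim A n'.

Hypotheses (splitC : idempotents_split)
  (stabC : forall X (h : hom X X), stabilizes h)
  (dimC : forall X, exists n, dim X n) (dropC : drops_on_retracts).

Lemma krull_schmidt_of_dimension : additive_category C -> krull_schmidt C.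
Proof.
move=> addC; split=> // X; have [n dimX] := dimC X.
elim/ltn_ind: n X dimX => n IHn X dimX.
have [X0|X0] := pselect (zero_object X).
  exists 0%N, (fun=> X); split; last by case.
  exists (fun=> 0), (fun=> 0); split; [by case | by case | by rewrite big_ord0 X0].
have [[e [ee e0 e1]] | idemX] :=
  pselect (exists e : hom X X, [/\ e \o e = e, e <> 0 & e <> idm X]); last first.
  exists 1%N, (fun=> X); split.
    exists (fun=> idm X), (fun=> idm X); split=> [i|i j|].
    - by rewrite ccomp1m.
    - by rewrite (ord1 i) (ord1 j) eqxx.
    - by rewrite big_ord1 ccomp1m.
  move=> _; apply: local_endo_of_idempotents => // e ee.
  have [|e0] := pselect (e = 0); [by left | right].
  by apply: contrapT => e1; apply: idemX; exists e.
have [A [B [i [r [j [q [ri qj qi rj [ir jq]]]]]]]] := split_idempotent2 splitC ee.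
have [|nA ltA dimA] := dropC ri _ dimX; first by rewrite ir.
have [|nB ltB dimB] := dropC qj _ dimX.
  by rewrite jq => /eqP; rewrite subr_eq -subr_eq0 opprD addNKr oppr_eq0 => /eqP.
have [n1 [F1 [sumA locA]]] := IHn _ ltA _ dimA.
have [n2 [F2 [sumB locB]]] := IHn _ ltB _ dimB.
exists (n1 + n2)%N; eexists; split.
  apply: (direct_sum_cat ri qj qi rj _ sumA sumB).
  by rewrite ir jq addrC subrK.
by move=> x /=; case: (split x) => a; [apply: locA | apply: locB].
Qed.

(** If [g h = g] with [h] not invertible, Fitting's lemma yields an idempotent [e]
  with [g e = g], and [g] may be restricted to the smaller image of [e]. *)
Lemma sink_of_right_almost_split Y Z (g : hom Y Z) :
  right_almost_split g -> exists Y' (g' : hom Y' Z), sink g'.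
Proof.
move=> g_ras; have [n dimY] := dimC Y.
elim/ltn_ind: n Y g g_ras dimY => n IHn Y g g_ras dimY.
have [|gN] := pselect (right_minimal g); first by exists Y, g.
have [h [gh hN]] : exists h, g \o h = g /\ ~ is_iso h.
  apply: contrapT => noh; apply: gN => h gh; apply: contrapT => hN.
  by apply: noh; exists h.
have [e [a [t [ee hae eE eiso]]]] := fitting (stabC h).
have ge : g \o e = g.
  have gha : g \o hpow h a = g.
    by elim: a {eE hae} => [|a IHa]; rewrite ?ccompm1 //= ccompA gh.
  by rewrite -{1}gha -ccompA hae gha.
have [A [i [r [ri ir]]]] := splitC ee.
have [|n' ltn' dimA] := dropC ri _ dimY; first by rewrite ir => /eiso.
apply: (IHn n' ltn' A (g \o i)) => //; split.
  by case=> s gis; apply: g_ras.1; exists (i \o s); rewrite ccompA.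
move=> W v vN; have [v' gv'] := g_ras.2 W v vN.
by exists (r \o v'); rewrite -ccompA (ccompA i) ir ccompA ge.
Qed.

End Dimension.

(** ** Kernels of sink morphisms *)

Definition kernel X Y Z (f : hom X Y) (g : hom Y Z) :=
  [/\ g \o f = 0, mono f &
      forall W (h : hom W Y), g \o h = 0 -> exists h', f \o h' = h].

Definition cokernel X Y Z (f : hom X Y) (g : hom Y Z) :=
  (forall W (u v : hom Z W), u \o g = v \o g -> u = v) /\
  forall W (h : hom Y W), h \o f = 0 -> exists h', h' \o g = h.

(** If [h f = f], then [1 - h] vanishes on the kernel, so [h = 1 - t g]. Here
  [1 - g t] is invertible because [g t] is not, and then so is [1 - t g]. *)
Lemma left_minimal_of_sink X Y Z (f : hom X Y) (g : hom Y Z) :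
  local_endo Z -> ~ split_epi g -> cokernel f g -> left_minimal f.
Proof.
move=> [_ locZ] gN [_ cok] h hf.
have [t tg] : exists t, t \o g = idm Y - h.
  by apply: cok; rewrite ccompBl hf ccomp1m subrr.
have [u [u1 u2]] : is_iso (idm Z - (g \o t)).
  apply: contrapT => gt1; have gtN := non_split_epi_comp (u := t) gN.
  apply: (locZ _ _ gtN gt1); rewrite addrC subrK.
  by exists (idm Z); rewrite ccomp1m.
have -> : h = idm Y - (t \o g) by rewrite tg opprB addrC subrK.
move: u1 u2; rewrite ccompBl ccompBr ccomp1m ccompm1 => u1 u2.
(* The inverse of [1 - t g] is [1 + t u g], for [u] the inverse of [1 - g t]. *)
exists (idm Y + (t \o (u \o g))).
split.
  rewrite ccompBr ccompm1 ccompDl ccomp1m opprD addrA.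
  have -> : (t \o (u \o g)) \o (t \o g) = (t \o (u \o g)) - (t \o g).
    have -> : (t \o (u \o g)) \o (t \o g) = t \o ((u \o (g \o t)) \o g).
      by rewrite !ccompA.
    have -> : u \o (g \o t) = u - idm Z by rewrite -u1 opprB addrC subrK.
    by rewrite ccompBl ccompBr ccomp1m.
  by rewrite opprB addrA subrK addrK.
rewrite ccompDr ccompm1 ccompBl ccomp1m.
have -> : (t \o g) \o (t \o (u \o g)) = (t \o (u \o g)) - (t \o g).
  have -> : (t \o g) \o (t \o (u \o g)) = t \o (((g \o t) \o u) \o g).
    by rewrite !ccompA.
  have -> : (g \o t) \o u = u - idm Z by rewrite -u2 opprB addrC subrK.
  by rewrite ccompBl ccompBr ccomp1m.
by rewrite opprB (addrCA _ (t \o g)) subrr addr0 subrK.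
Qed.

(** If a map [h] out of the kernel [X] of a sink [g] does not extend along
  [f : X -> Y], its pushout [W -> E -> Z] does not split, so [E -> Z] factors
  through [g]. The composite [Y -> E -> Y] is then invertible by minimality, and
  its restriction to [X] factors through [h], which is thus a split mono. *)
Lemma source_of_sink X Y Z (f : hom X Y) (g : hom Y Z) :
  local_endo Z -> sink g -> kernel f g -> cokernel f g ->
  (forall W (h : hom X W), exists E (w : hom W E) (e : hom E Z) (y : hom Y E),
    [/\ y \o f = w \o h, e \o y = g & kernel w e]) ->
  source f.
Proof.
move=> locZ [g_min [gN g_ras]] [gf f_mono f_ker] [g_epi g_cok] push.
split; first exact: left_minimal_of_sink locZ gN _.
split.
  move=> [r rf]; have [s sg] : exists s, s \o g = idm Y - (f \o r).
    by apply: g_cok; rewrite ccompBl ccomp1m -ccompA rf ccompm1 subrr.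
  apply: gN; exists s; apply: g_epi.
  by rewrite -ccompA sg ccompBr ccompm1 ccompA gf ccomp0m subr0 ccomp1m.
move=> W h hN; have [E [w [e [y [yf ey [ew w_mono w_ker]]]]]] := push W h.
have [[s es]|eN] := pselect (split_epi e).
  have [v wv] : exists v, w \o v = idm E - (s \o e).
    by apply: w_ker; rewrite ccompBr ccompm1 ccompA es ccomp1m subrr.
  exists (v \o y); apply: w_mono.
  rewrite !ccompA wv ccompBl ccomp1m ccompBl yf -(ccompA s) ey -(ccompA s) gf.
  by rewrite ccompm0 subr0.
have [p gp] := g_ras _ _ eN.
have [a [apy pya]] : is_iso (p \o y) by apply: g_min; rewrite ccompA gp.
have ga : g \o a = g by rewrite -{1}ey -gp -(ccompA g) -ccompA pya ccompm1.
have [x fx] : exists x, f \o x = p \o w by apply: f_ker; rewrite ccompA gp.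
have [b fb] : exists b, f \o b = a \o f by apply: f_ker; rewrite ccompA ga.
case: hN; exists (b \o x); apply: f_mono.
rewrite !ccompA fb -(ccompA a) fx -!ccompA -yf !ccompA -(ccompA a p) apy.
by rewrite ccomp1m ccompm1.
Qed.

End Abstract.

(** * Linear algebra over the base field *)

Definition mklin (R : nzRingType) (M N : lmodType R) (f : M -> N) (f_lin : linear f) :
    {linear M -> N} :=
  HB.pack f (GRing.isLinear.Build R M N *:%R f f_lin).

Section LinearAlgebra.
Variable k : fieldType.

Definition subspace (V : lmodType k) (S : V -> Prop) :=
  S 0 /\ forall c u v, S u -> S v -> S (c *: u + v).

(** Take a subspace of greatest dimension among those contained in [S]. *)
Lemma subspace_vspace (V : vectType k) (S : V -> Prop) : subspace S ->
  exists U : {vspace V}, forall x, x \in U <-> S x.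
Proof.
move=> [S0 SD].
pose P n := `[< exists U : {vspace V}, (forall x, x \in U -> S x) /\ \dim U = n >].
have exP : exists n, P n.
  exists 0%N; apply/asboolP; exists 0%VS; split; last by rewrite dimv0.
  by move=> x; rewrite memv0 => /eqP->.
have ubP n : P n -> (n <= \dim {:V})%N.
  by move=> /asboolP [U [_ <-]]; rewrite dimvS ?subvf.
case: (ex_maxnP exP ubP) => n /asboolP [U [US dimU]] n_max.
exists U => x; split=> [|Sx]; first exact: US.
apply: contrapT => /negP xU.
suff /n_max : P (\dim (U + <[x]>)).
  rewrite -dimU; apply/negP; rewrite -ltnNge.
  rewrite ltn_neqAle dimvS ?addvSl // andbT; apply: contraNneq xU => eq_dim.
  have /eqP-> : U == (U + <[x]>)%VS by rewrite eqEdim addvSl -eq_dim leqnn.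
  by rewrite -[X in X \in _]add0r memv_add ?mem0v ?memv_line.
apply/asboolP; exists (U + <[x]>)%VS; split=> // y.
move=> /memv_addP [u uU [_ /vlineP [c ->] ->]].
by rewrite addrC; apply: SD => //; apply: US.
Qed.

Definition embeddable (U : lmodType k) :=
  exists (V : vectType k) (f : {linear U -> V}), injective f.

Lemma functional_separating (U : lmodType k) (S : U -> Prop) v :
  embeddable U -> subspace S -> ~ S v ->
  exists f : {linear U -> k^o}, (forall u, S u -> f u = 0) /\ f v = 1.
Proof.
move=> [V [i i_inj]] [S0 SD] Sv.
have [|T TE] := @subspace_vspace V (fun x => exists2 u, S u & x = i u).
  split; first by exists 0; rewrite ?linear0.
  move=> c _ _ [x Sx ->] [y Sy ->]; exists (c *: x + y); first exact: SD.
  by rewrite linearP.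
pose p : {linear V -> V} := (\1 - projv T)%VF.
have pE x : p x = x - projv T x by rewrite /p /= !lfunE /= lfunE /= lfunE.
have iv0 : p (i v) != 0.
  rewrite pE subr_eq0; apply/eqP => ivE; apply: Sv.
  have : i v \in T by rewrite ivE memv_proj.
  by case/TE => u Su /i_inj ->.
have [j cj0] : exists j, coord (vbasis {:V}) j (p (i v)) != 0.
  apply: contrapT => noj; case/eqP: iv0.
  rewrite (coord_vbasis (memvf (p (i v)))) big1 // => j _.
  have [-> |cj] := eqVneq (coord (vbasis {:V}) j (p (i v))) 0; first by rewrite scale0r.
  by case: noj; exists j.
pose f u : k^o := (coord (vbasis {:V}) j (p (i v)))^-1 * coord (vbasis {:V}) j (p (i u)).
have f_lin : linear f by move=> a x y; rewrite /f !linearP mulrDr /= mulrCA.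
exists (mklin f_lin); split=> [u Su|] /=; rewrite /f; last by rewrite mulVf.
have uT : i u \in T by apply: (TE (i u)).2; exists u.
by rewrite (pE (i u)) projv_id // subrr linear0 mulr0.
Qed.

Lemma embeddable_pair (U : lmodType k) :
  embeddable U -> embeddable (U * k^o)%type.
Proof.
move=> [V [i i_inj]]; exists (V * k^o)%type.
pose f (x : U * k^o) : V * k^o := (i x.1, x.2).
have f_lin : linear f by move=> a x y; rewrite /f /= linearP.
by exists (mklin f_lin) => -[x1 x2] [y1 y2] [/i_inj-> ->].
Qed.

(** The graph [{(D a, f a)}] does not contain [(0, 1)]; restricted to [B], a
  functional separating the two is the extension up to sign. *)
Lemma functional_extension (A B : lmodType k) (D : {linear A -> B})
    (f : {linear A -> k^o}) : embeddable B ->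
  (forall a, D a = 0 -> f a = 0) ->
  exists g : {linear B -> k^o}, forall a, g (D a) = f a.
Proof.
move=> embB Df; pose S (x : B * k^o) := exists a, x = (D a, f a).
have [||q [qS q01]] := @functional_separating _ S (0, 1) (embeddable_pair embB).
- split; first by exists 0; rewrite !linear0.
  by move=> c _ _ [a ->] [b ->]; exists (c *: a + b); rewrite !linearP.
- by case=> a [/esym/Df fa0 /eqP]; rewrite fa0 oner_eq0.
have q2 c : q (0, c) = c.
  have -> : ((0, c) : B * k^o) = c *: ((0, 1) : B * k^o).
    by congr (_, _); rewrite /= ?scaler0 // [c *: _]mulr1.
  by rewrite linearZ q01 [LHS]mulr1.
pose g x : k^o := - q (x, 0).
have g_lin : linear g.
  move=> a x y; rewrite /g.
  have -> : ((a *: x + y, 0) : B * k^o) = a *: ((x, 0) : B * k^o) + (y, 0).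
    by congr (_, _); rewrite /= scaler0 addr0.
  by rewrite linearP opprD scalerN.
exists (mklin g_lin) => a /=; apply/eqP; rewrite eq_sym -subr_eq0 opprK.
have : q (D a, f a) = 0 by apply: qS; exists a.
have -> : ((D a, f a) : B * k^o) = (0, f a) + (D a, 0).
  by congr (_, _); rewrite /= ?add0r ?addr0.
by rewrite linearD /= q2 => ->.
Qed.

End LinearAlgebra.

(** * Modules over a ring *)

Lemma dependent_choice (I : Type) (F : I -> Type) (P : forall i, F i -> Prop) :
  (forall i, exists x, P i x) -> exists f : forall i, F i, forall i, P i (f i).
Proof. by move=> FP; exists (fun i => sval (cid (FP i))) => i; case: cid. Qed.

Section Modules.
Variable R : nzRingType.
Implicit Types M N P : lmodType R.

Definition free_module n : lmodType R := {ffun 'I_n -> R^o}.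

Lemma free_sum n (c : free_module n) :
  c = \sum_l c l *: ([ffun l' => (l == l')%:R] : free_module n).
Proof.
apply/ffunP => l; rewrite sum_ffunE (bigD1 l) //= big1 => [|l' l'l].
  by rewrite !ffunE eqxx [_ *: _]mulr1 addr0.
by rewrite !ffunE (negbTE l'l) scaler0.
Qed.

Lemma free_to_linear n M (e : 'I_n -> M) :
  linear (fun c : free_module n => \sum_l c l *: e l).
Proof.
move=> a x y; rewrite scaler_sumr -big_split; apply: eq_bigr => l _ /=.
by rewrite !ffunE scalerDl scalerA.
Qed.

Definition free_to n M (e : 'I_n -> M) : {linear free_module n -> M} :=
  mklin (@free_to_linear n M e).

Lemma finitely_generated_free n : finitely_generated (free_module n).
Proof.
by exists n, (fun l => [ffun l' => (l == l')%:R]) => x; exists x; apply: free_sum.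
Qed.

Lemma projective_free n : projective (free_module n).
Proof.
move=> M N p f p_surj.
have [e eE] := choice (fun l => p_surj (f [ffun l' => (l == l')%:R])).
exists (free_to e) => x /=.
rewrite [in RHS](free_sum x) !linear_sum; apply: eq_bigr => l _.
by rewrite !linearZ /= eE.
Qed.

Lemma finitely_generated_image M N (p : {linear M -> N}) :
  (forall y, exists x, p x = y) -> finitely_generated M -> finitely_generated N.
Proof.
move=> p_surj [n [e eM]]; exists n, (fun l => p (e l)) => y.
have [x <-] := p_surj y; have [c ->] := eM x; exists c.
by rewrite linear_sum; apply: eq_bigr => l _; rewrite linearZ.
Qed.

Lemma finitely_generated_cover M : finitely_generated M ->
  exists n (p : {linear free_module n -> M}), forall y, exists x, p x = y.
Proof.
move=> [n [e eM]]; exists n, (free_to e) => y; have [c ->] := eM y.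
by exists (finfun c); apply: eq_bigr => l _; rewrite ffunE.
Qed.

Lemma projective_retract M P (i : {linear M -> P}) (r : {linear P -> M}) :
  cancel i r -> projective P -> projective M.
Proof.
move=> ir projP N N' p f p_surj.
have [g gE] := projP _ _ p (f \o r)%FUN p_surj.
by exists (g \o i)%FUN => x /=; rewrite gE /= ir.
Qed.

Lemma projective_section P N (p : {linear N -> P}) :
  projective P -> (forall y, exists x, p x = y) ->
  exists s : {linear P -> N}, cancel s p.
Proof.
by move=> projP /(projP _ _ p idfun) [s sE]; exists s => x; rewrite sE.
Qed.

Lemma fg_projective_retract P : finitely_generated P -> projective P ->
  exists n (i : {linear P -> free_module n}) (r : {linear free_module n -> P}),
    cancel i r.
Proof.
move=> /finitely_generated_cover [n [r r_surj]] projP.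
by have [i ri] := projective_section projP r_surj; exists n, i, r.
Qed.

Lemma finitely_generated_regular : finitely_generated R^o.
Proof.
by exists 1%N, (fun=> 1) => y; exists (fun=> y); rewrite big_ord1 [_ *: _]mulr1.
Qed.

Lemma projective_regular : projective R^o.
Proof.
have i_lin : linear (fun x : R^o => [ffun=> x] : free_module 1).
  by move=> a y z; apply/ffunP => l; rewrite !ffunE.
have r_lin : linear (fun x : free_module 1 => x ord0 : R^o).
  by move=> a y z; rewrite !ffunE.
apply: (projective_retract (i := mklin i_lin) (r := mklin r_lin)) => [y|].
  by rewrite /= ffunE.
exact: projective_free.
Qed.

Lemma scale_linear M (x : M) : linear (fun a : R^o => a *: x).
Proof. by move=> a b c; rewrite scalerDl scalerA. Qed.

Definition scale_map M (x : M) : {linear R^o -> M} := mklin (scale_linear x).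

Definition is_submodule M (S : M -> Prop) :=
  S 0 /\ forall a x y, S x -> S y -> S (a *: x + y).

(** This form, without coefficients, passes to products at once. *)
Lemma finitely_generatedP M : finitely_generated M <->
  exists s : seq M, forall S, is_submodule S ->
    (forall x, x \in s -> S x) -> forall x, S x.
Proof.
split=> [[n [e eM]]|[s sM]].
  exists (codom e) => S [S0 SD] eS x; have [c ->] := eM x.
  elim/big_rec: _ => // l y _ Sy; apply: SD => //; apply: eS.
  exact: codom_f.
exists (size s), (fun l => s`_l); apply: sM => [|x xs].
  split; first by exists (fun=> 0); rewrite big1 // => l _; rewrite scale0r.
  move=> a _ _ [c ->] [c' ->]; exists (fun l => a * c l + c' l).
  rewrite scaler_sumr -big_split; apply: eq_bigr => l _.
  by rewrite scalerDl scalerA.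
have ix : (index x s < size s)%N by rewrite index_mem.
exists (fun l => (l == Ordinal ix)%:R).
rewrite (bigD1 (Ordinal ix)) //= eqxx scale1r nth_index // big1 ?addr0 //.
by move=> l /negbTE ->; rewrite scale0r.
Qed.

Lemma is_submodule_preim M N (f : {linear M -> N}) (S : N -> Prop) :
  is_submodule S -> is_submodule (fun x => S (f x)).
Proof.
move=> [S0 SD]; split=> [|a x y Sx Sy]; first by rewrite linear0.
by rewrite linearP; apply: SD.
Qed.

Lemma is_submoduleD M (S : M -> Prop) x y :
  is_submodule S -> S x -> S y -> S (x + y).
Proof. by move=> [_ SD] Sx Sy; rewrite -[x]scale1r; apply: SD. Qed.

(** ** Products *)

Lemma pair_inl_linear M N : linear (fun x : M => (x, 0) : M * N).
Proof. by move=> a x y; congr (_, _); rewrite /= scaler0 addr0. Qed.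

Lemma pair_inr_linear M N : linear (fun y : N => (0, y) : M * N).
Proof. by move=> a x y; congr (_, _); rewrite /= scaler0 addr0. Qed.

Definition pair_inl M N : {linear M -> (M * N)%type} := mklin (@pair_inl_linear M N).
Definition pair_inr M N : {linear N -> (M * N)%type} := mklin (@pair_inr_linear M N).

Lemma pair_split M N (x : M) (y : N) :
  ((x, y) : M * N) = pair_inl M N x + pair_inr M N y.
Proof. by congr (_, _); rewrite /= ?addr0 ?add0r. Qed.

Lemma projective_pair M N :
  projective M -> projective N -> projective (M * N)%type.
Proof.
move=> projM projN A B p f p_surj.
have [g gE] := projM _ _ p (f \o pair_inl M N)%FUN p_surj.
have [h hE] := projN _ _ p (f \o pair_inr M N)%FUN p_surj.
exists ((g \o fst) \+ (h \o snd))%FUN => -[x y] /=.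
by rewrite linearD gE hE [in RHS]pair_split [RHS]linearD.
Qed.

Lemma finitely_generated_pair M N : finitely_generated M ->
  finitely_generated N -> finitely_generated (M * N)%type.
Proof.
move=> /finitely_generatedP [s sM] /finitely_generatedP [t tN].
apply/finitely_generatedP.
exists (map (pair_inl M N) s ++ map (pair_inr M N) t) => S subS stS [x y].
rewrite pair_split; apply: is_submoduleD => //.
  apply: (sM (fun x => S (pair_inl M N x))); first exact: is_submodule_preim.
  by move=> z zs; apply: stS; rewrite mem_cat map_f.
apply: (tN (fun x => S (pair_inr M N x))); first exact: is_submodule_preim.
by move=> z zt; apply: stS; rewrite mem_cat (map_f (pair_inr M N)) ?orbT.
Qed.

End Modules.

Section DependentProduct.
Variables (R : nzRingType) (I : finType) (F : I -> lmodType R).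

Definition dprod := forall i, F i.

HB.instance Definition _ := gen_eqMixin dprod.
HB.instance Definition _ := gen_choiceMixin dprod.

Implicit Types x y : dprod.

Definition dprod_add x y : dprod := fun i => x i + y i.
Definition dprod_zero : dprod := fun=> 0.
Definition dprod_opp x : dprod := fun i => - x i.
Definition dprod_scale a x : dprod := fun i => a *: x i.

Lemma dprodP x y : (forall i, x i = y i) -> x = y.
Proof. exact: functional_extensionality_dep. Qed.

Lemma dprod_addA : associative dprod_add.
Proof. by move=> x y z; apply: dprodP => i; apply: addrA. Qed.

Lemma dprod_addC : commutative dprod_add.
Proof. by move=> x y; apply: dprodP => i; apply: addrC. Qed.

Lemma dprod_add0 : left_id dprod_zero dprod_add.
Proof. by move=> x; apply: dprodP => i; apply: add0r. Qed.

Lemma dprod_addN : left_inverse dprod_zero dprod_opp dprod_add.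
Proof. by move=> x; apply: dprodP => i; apply: addNr. Qed.

HB.instance Definition _ :=
  GRing.isZmodule.Build dprod dprod_addA dprod_addC dprod_add0 dprod_addN.

Lemma dprod_scaleA a b x : dprod_scale a (dprod_scale b x) = dprod_scale (a * b) x.
Proof. by apply: dprodP => i; apply: scalerA. Qed.

Lemma dprod_scale1 : left_id 1 dprod_scale.
Proof. by move=> x; apply: dprodP => i; apply: scale1r. Qed.

Lemma dprod_scaleDr : right_distributive dprod_scale +%R.
Proof. by move=> a x y; apply: dprodP => i; apply: scalerDr. Qed.

Lemma dprod_scaleDl x : {morph dprod_scale^~ x : a b / a + b}.
Proof. by move=> a b; apply: dprodP => i; apply: scalerDl. Qed.

HB.instance Definition _ := GRing.Zmodule_isLmodule.Build R dprod
  dprod_scaleA dprod_scale1 dprod_scaleDr dprod_scaleDl.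

Lemma dprodDE x y i : (x + y) i = x i + y i. Proof. by []. Qed.

Lemma dprodZE a x i : (a *: x) i = a *: x i. Proof. by []. Qed.

Lemma dprod_proj_linear i : linear (fun x : dprod => x i).
Proof. by []. Qed.

Definition dprod_proj i : {linear dprod -> F i} := mklin (@dprod_proj_linear i).

Definition dprod_inj_fun i (x : F i) : dprod := dfwith (fun j => 0 : F j) x.

Lemma dprod_inj_linear i : linear (@dprod_inj_fun i).
Proof.
move=> a x y; apply: dprodP => j; rewrite /dprod_inj_fun.
rewrite dprodDE dprodZE.
have [<-|ij] := eqVneq i j; first by rewrite !dfwith_in.
by rewrite !dfwith_out //= scaler0 addr0.
Qed.

Definition dprod_inj i : {linear F i -> dprod} := mklin (@dprod_inj_linear i).

Lemma dprod_injK i : cancel (dprod_inj i) (dprod_proj i).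
Proof. by move=> x /=; rewrite /dprod_inj_fun dfwith_in. Qed.

Lemma dprod_inj_out i j (x : F i) : i != j -> dprod_proj j (dprod_inj i x) = 0.
Proof. by move=> ij /=; rewrite /dprod_inj_fun dfwith_out. Qed.

Lemma dprod_sumE (J : Type) (s : seq J) (x : J -> dprod) i :
  (\sum_(j <- s) x j) i = \sum_(j <- s) x j i.
Proof. exact: (linear_sum (dprod_proj i)). Qed.

Lemma dprod_split x : x = \sum_i dprod_inj i (x i).
Proof.
apply: dprodP => j; rewrite dprod_sumE (bigD1 j) //= big1 => [|i ij].
  by rewrite addr0 /dprod_inj_fun dfwith_in.
exact: dprod_inj_out.
Qed.

Lemma finitely_generated_dprod :
  (forall i, finitely_generated (F i)) -> finitely_generated dprod.
Proof.
move=> fgF; have [s sF] := dependent_choice (fun i =>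
  (finitely_generatedP (F i)).1 (fgF i)).
apply/finitely_generatedP.
exists (flatten [seq map (dprod_inj i) (s i) | i <- enum I]) => S subS sS x.
rewrite (dprod_split x); elim/big_rec: _ => [|i y _ Sy]; first exact: subS.1.
apply: is_submoduleD => //.
apply: (sF i (fun z => S (dprod_inj i z))); first exact: is_submodule_preim.
move=> z zs; apply: sS; apply/flatten_mapP; exists i; rewrite ?mem_enum //.
exact: (map_f (dprod_inj i)).
Qed.

Lemma projective_dprod : (forall i, projective (F i)) -> projective dprod.
Proof.
move=> projF A B p f p_surj.
have [g gE] := dependent_choice (fun i => projF i _ _ p (f \o dprod_inj i)%FUN p_surj).
have h_lin : linear (fun x : dprod => \sum_i g i (x i)).
  move=> a x y; rewrite scaler_sumr -big_split; apply: eq_bigr => i _ /=.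
  by rewrite -linearP.
exists (mklin h_lin) => x /=.
rewrite {2}(dprod_split x) !linear_sum; apply: eq_bigr => i _.
by rewrite gE.
Qed.

End DependentProduct.

(** * Submodules *)

Section SubmoduleOf.
Variables (R : nzRingType) (M : lmodType R) (S : M -> Prop).
Hypothesis subS : is_submodule S.

Definition prop_pred : {pred M} := fun x => `[< S x >].

Lemma prop_pred_closed : submod_closed prop_pred.
Proof.
split=> [|a x y]; first by apply/asboolP; apply: subS.1.
move=> /asboolP Sx /asboolP Sy.
by apply/asboolP; apply: subS.2.
Qed.

Definition submod_closed_of : submodClosed M :=
  HB.pack prop_pred (GRing.isSubmodClosed.Build R M prop_pred prop_pred_closed).

Definition submod : lmodType R := submodule submod_closed_of.

Definition submod_val : {linear submod -> M} := val.

Lemma submod_val_inj : injective submod_val.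
Proof. exact: val_inj. Qed.

Lemma submod_valP (x : submod) : S (submod_val x).
Proof. exact/asboolP/(submodule_valP x). Qed.

Definition submod_mk x (Sx : S x) : submod :=
  Submodule (introT (asboolP (S x)) Sx : x \in submod_closed_of).

Lemma submod_mkE x (Sx : S x) : submod_val (submod_mk Sx) = x.
Proof. by []. Qed.

Variables (N : lmodType R) (f : {linear N -> M}).
Hypothesis fS : forall x, S (f x).

Lemma submod_lift_linear : linear (fun x => submod_mk (fS x)).
Proof. by move=> a x y; apply: submod_val_inj; rewrite [RHS]linearP /= linearP. Qed.

Definition submod_lift : {linear N -> submod} := mklin submod_lift_linear.

Lemma submod_liftE x : submod_val (submod_lift x) = f x.
Proof. by []. Qed.

End SubmoduleOf.

(** * Finite dimensional algebras *)

Section FiniteDimensionalAlgebra.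
Variables (k : fieldType) (H : falgType k).
Implicit Types (M N P Q : lmodType H) (c : k).

Lemma scalar_central c (h : H) : c%:A * h = h * c%:A.
Proof. by rewrite mulr_algl mulr_algr. Qed.

Lemma scalar_mul c c' : (c * c')%:A = c%:A * c'%:A :> H.
Proof. by rewrite mulr_algl scalerA. Qed.

Lemma scalar_commute M c (h : H) (x : M) : c%:A *: (h *: x) = h *: (c%:A *: x).
Proof. by rewrite !scalerA scalar_central. Qed.

(** ** Spaces of linear maps *)

Section LinearMapLmod.
Variables P Q : lmodType H.
Implicit Types f g : linear_map P Q.

Lemma lm_scale_linear c f : linear (fun x => (c%:A : H) *: f x).
Proof. by move=> a x y; rewrite linearP scalerDr scalar_commute. Qed.

Definition lm_scale c f : linear_map P Q := mklin (lm_scale_linear c f).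

Lemma lm_scaleA c c' f : lm_scale c (lm_scale c' f) = lm_scale (c * c') f.
Proof. by apply: linear_map_ext => x /=; rewrite scalerA -scalar_mul. Qed.

Lemma lm_scale1 : left_id 1 lm_scale.
Proof. by move=> f; apply: linear_map_ext => x /=; rewrite !scale1r. Qed.

Lemma lm_scaleDr : right_distributive lm_scale +%R.
Proof. by move=> c f g; apply: linear_map_ext => x /=; rewrite scalerDr. Qed.

Lemma lm_scaleDl f : {morph lm_scale^~ f : c c' / c + c'}.
Proof. by move=> c c'; apply: linear_map_ext => x /=; rewrite !scalerDl. Qed.

HB.instance Definition _ := GRing.Zmodule_isLmodule.Build k (linear_map P Q)
  lm_scaleA lm_scale1 lm_scaleDr lm_scaleDl.

End LinearMapLmod.

Lemma lmDE P Q (f g : linear_map P Q) x : (f + g) x = f x + g x.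
Proof. by []. Qed.

Lemma lmZE P Q c (f : linear_map P Q) x : (c *: f) x = c%:A *: f x.
Proof. by []. Qed.

(** The carrier of [free_module H n], with scalars restricted to [k]. *)
Definition free_space n : vectType k := {ffun 'I_n -> H}.

Lemma free_spaceZ n c (x : free_module H n) :
  c%:A *: x = c *: (x : free_space n).
Proof. by apply/ffunP => i; rewrite !ffunE [_ *: _]mulr_algl. Qed.

(** A map out of [P] is determined by its values at finitely many generators. *)
Lemma embeddable_hom P Q n (i : {linear Q -> free_module H n}) :
  finitely_generated P -> injective i -> embeddable (linear_map P Q).
Proof.
move=> [g [e eP]] i_inj.
pose ev (f : linear_map P Q) : {ffun 'I_g -> free_space n} := [ffun l => i (f (e l))].
have ev_lin : linear ev.
  move=> c f f'; apply/ffunP => l; rewrite !ffunE lmDE linearD /=; congr (_ + _).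
  by rewrite linearZ /= free_spaceZ.
exists {ffun 'I_g -> free_space n}, (mklin ev_lin) => f f' /= /ffunP ff'.
apply: linear_map_ext => x; have [c ->] := eP x.
rewrite !linear_sum; apply: eq_bigr => l _; rewrite !linearZ; congr (_ *: _).
by have /= := ff' l; rewrite !ffunE => /i_inj.
Qed.

(** ** Noetherianity and heredity *)

(** Submodules of [H^n] are finite dimensional, and a basis generates. *)
Lemma finitely_generated_of_embedding M n (i : {linear M -> free_module H n}) :
  injective i -> finitely_generated M.
Proof.
move=> i_inj.
have [|U UE] := @subspace_vspace _ (free_space n) (fun y => exists x, y = i x).
  split; first by exists 0; rewrite linear0.
  move=> c _ _ [x ->] [y ->]; exists ((c%:A : H) *: x + y).
  by rewrite linearD linearZ /= free_spaceZ.
have eP (l : 'I_(\dim U)) : exists x : M, (vbasis U)`_l = i x.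
  by apply/UE/vbasis_mem/mem_nth; rewrite size_tuple.
have [e eE] := choice eP; exists (\dim U), e => x.
exists (fun l => (coord (vbasis U) l (i x))%:A).
apply: i_inj; rewrite linear_sum [LHS](coord_vbasis ((UE (i x)).2 _)); last by exists x.
by apply: eq_bigr => l _; rewrite linearZ /= free_spaceZ -eE.
Qed.

(** The first coordinate of a submodule of [H^(n+1)] ranges over a left ideal,
  which is projective; so the submodule splits into this ideal and a submodule
  of [H^n]. *)
Lemma hereditary_projective M n (i : {linear M -> free_module H n}) :
  hereditary H -> injective i -> projective M.
Proof.
move=> herH; elim: n M i => [|n IHn] M i i_inj.
  move=> A B p f _; exists \0 => x; rewrite linear0.
  have -> : x = 0 by apply: i_inj; apply/ffunP => -[].
  by rewrite linear0.
have c_lin : linear (fun x : M => i x ord0 : H^o).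
  by move=> a x y; rewrite linearP !ffunE.
pose c : {linear M -> H^o} := mklin c_lin.
pose I y := exists x, y = c x.
have subI : is_submodule I.
  split; first by exists 0; rewrite linear0.
  by move=> a _ _ [x ->] [y ->]; exists (a *: x + y); rewrite linearP.
have projI : projective (submod subI) by exact: herH.
have cI x : I (c x) by exists x.
pose c' : {linear M -> submod subI} := submod_lift subI cI.
have c'_surj y : exists x, c' x = y.
  have [x xE] := submod_valP y; exists x.
  by apply: submod_val_inj; rewrite submod_liftE.
have [s sK] := projective_section projI c'_surj.
have subK : is_submodule (fun x => c' x = 0).
  split=> [|a x y x0 y0]; first exact: linear0.
  by rewrite linearP x0 y0 scaler0 addr0.
pose t (u : free_module H n.+1) : free_module H n := [ffun j => u (lift ord0 j)].
have t_lin : linear t by move=> a x y; apply/ffunP => j; rewrite !ffunE.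
have projK : projective (submod subK).
  apply: (IHn _ (mklin t_lin \o (i \o submod_val subK))%FUN).
  move=> x y xy; apply: submod_val_inj; apply: i_inj; apply/ffunP => j.
  have c0 (z : submod subK) : i (submod_val subK z) ord0 = 0.
    by rewrite -[LHS](submod_liftE subI cI) [submod_lift _ _ _](submod_valP z) linear0.
  case: (unliftP ord0 j) => [j'|] ->; last by rewrite !c0.
  by have /ffunP /(_ j') := xy; rewrite !ffunE.
have r_lin : linear (fun x => x - s (c' x)).
  by move=> a x y; rewrite [c' _]linearP [s _]linearP scalerBr opprD addrACA.
have rK x : c' (x - s (c' x)) = 0 by rewrite linearB [X in _ - X]sK subrr.
pose r := submod_lift subK (f := mklin r_lin) rK.
move=> A B p f p_surj.
have [g1 g1E] := projI _ _ p (f \o s)%FUN p_surj.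
have [g2 g2E] := projK _ _ p (f \o submod_val subK)%FUN p_surj.
exists ((g1 \o c') \+ (g2 \o r))%FUN => x /=.
by rewrite linearD g1E g2E /= -linearD addrC subrK.
Qed.

End FiniteDimensionalAlgebra.

(** * Periodic complexes of projective modules *)

Section PeriodicComplexes.
Variables (R : nzRingType) (m : nat).

Local Notation cx := (periodic_complexes (proj R) m).
Implicit Types X Y Z W : cx.

Definition deg X (i : 'I_m) : lmodType R := pc_obj X i : fg_projective R.

Definition dif X i : {linear deg X i -> deg X (ordS i)} := pc_d X i.

Definition cmap X Y (f : hom X Y) i : {linear deg X i -> deg Y i} := cm_fun f i.

Lemma deg_fg X i : finitely_generated (deg X i).
Proof. exact: fgp_finitely_generated. Qed.

Lemma deg_projective X i : projective (deg X i).
Proof. exact: fgp_projective. Qed.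

Lemma difK X i x : dif X (ordS i) (dif X i x) = 0.
Proof. exact: (congr1 (fun f : linear_map _ _ => f x) (pc_dd X i)). Qed.

Lemma cmap_dif X Y (f : hom X Y) i x :
  cmap f (ordS i) (dif X i x) = dif Y i (cmap f i x).
Proof. exact: (congr1 (fun f : linear_map _ _ => f x) (cm_comm f i)). Qed.

Lemma cmapP X Y (f g : hom X Y) : (forall i x, cmap f i x = cmap g i x) -> f = g.
Proof.
by move=> fg; apply: chain_map_ext => i; apply: linear_map_ext; apply: fg.
Qed.

Lemma cmap_comp X Y Z (g : hom Y Z) (f : hom X Y) i x :
  cmap (g \o f) i x = cmap g i (cmap f i x).
Proof. by []. Qed.

Lemma cmap_id X i x : cmap (idm X) i x = x.
Proof. by []. Qed.

Lemma cmapD X Y (f g : hom X Y) i x : cmap (f + g) i x = cmap f i x + cmap g i x.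
Proof. by []. Qed.

Lemma cmapB X Y (f g : hom X Y) i x : cmap (f - g) i x = cmap f i x - cmap g i x.
Proof. by []. Qed.

Lemma cmap0 X Y i x : cmap (0 : hom X Y) i x = 0.
Proof. by []. Qed.

Lemma cmap_sum (J : finType) X Y (f : J -> hom X Y) i x :
  cmap (\sum_j f j) i x = \sum_j cmap (f j) i x.
Proof. by elim/big_rec2: _ => // j _ y _ <-. Qed.

(** ** Building complexes and chain maps *)

Section MakeComplex.
Variables (D : 'I_m -> lmodType R) (d : forall i, {linear D i -> D (ordS i)}).
Hypotheses (fgD : forall i, finitely_generated (D i))
  (projD : forall i, projective (D i))
  (dd : forall i x, d (ordS i) (d i x) = 0).

Definition mkcx_obj i : proj R := FgProjective (fgD i) (@projD i).

Lemma mkcx_dd i :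
  ((d (ordS i) : hom (mkcx_obj _) (mkcx_obj _)) \o (d i : hom (mkcx_obj _) (mkcx_obj _)))
  = 0.
Proof. by apply: linear_map_ext => x; apply: dd. Qed.

Definition mkcx : cx := PComplex mkcx_dd.

End MakeComplex.

Section MakeChainMap.
Variables (X Y : cx) (f : forall i, {linear deg X i -> deg Y i}).
Hypothesis fd : forall i x, f (ordS i) (dif X i x) = dif Y i (f i x).

Lemma mkcmap_comm i : ((f (ordS i) : hom (pc_obj X _) (pc_obj Y _)) \o pc_d X i)
  = (pc_d Y i \o (f i : hom (pc_obj X i) (pc_obj Y i))).
Proof. by apply: linear_map_ext => x; apply: fd. Qed.

Definition mkcmap : hom X Y := ChainMap mkcmap_comm.

Lemma mkcmapE i x : cmap mkcmap i x = f i x.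
Proof. by []. Qed.

End MakeChainMap.

Section Subcomplex.
Variables (X : cx) (S : forall i, deg X i -> Prop).
Hypotheses (subS : forall i, is_submodule (@S i))
  (dS : forall i x, S x -> S (dif X i x))
  (fgS : forall i, finitely_generated (submod (subS i)))
  (projS : forall i, projective (submod (subS i))).

Lemma subcx_dS i (x : submod (subS i)) : S (dif X i (submod_val (subS i) x)).
Proof. by apply: dS; apply: submod_valP. Qed.

Definition subcx_d i : {linear submod (subS i) -> submod (subS (ordS i))} :=
  submod_lift (subS (ordS i)) (f := dif X i \o submod_val (subS i))%FUN (@subcx_dS i).

Lemma subcx_dd i x : subcx_d (ordS i) (subcx_d i x) = 0.
Proof. by apply: submod_val_inj; rewrite /= difK. Qed.

Definition subcx : cx := mkcx fgS projS subcx_dd.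

Definition subcx_incl : hom subcx X :=
  @mkcmap subcx X (fun i => submod_val (subS i)) (fun i x => erefl).

Lemma subcx_incl_inj i : injective (cmap subcx_incl i).
Proof. exact: submod_val_inj. Qed.

Lemma subcx_inclP i x : S (cmap subcx_incl i x).
Proof. exact: submod_valP. Qed.

Lemma subcx_in i x : S x -> exists y, cmap subcx_incl i y = x.
Proof. by move=> Sx; exists (submod_mk (subS i) Sx). Qed.

Lemma subcx_lift W (f : hom W X) : (forall i x, S (cmap f i x)) ->
  exists g : hom W subcx, subcx_incl \o g = f.
Proof.
move=> fS.
have gd i x : submod_lift (subS (ordS i)) (fS (ordS i)) (dif W i x)
    = dif subcx i (submod_lift (subS i) (fS i) x).
  by apply: submod_val_inj; rewrite /= cmap_dif.
exists (@mkcmap W subcx (fun i => submod_lift (subS i) (fS i)) gd).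
exact: cmapP.
Qed.

End Subcomplex.

Lemma retract_submod_fg (M : lmodType R) (S : M -> Prop) (subS : is_submodule S)
    (r : {linear M -> M}) : (forall x, S (r x)) -> (forall x, S x -> r x = x) ->
  finitely_generated M -> finitely_generated (submod subS).
Proof.
move=> rS rK; apply: finitely_generated_image (submod_lift subS rS) _ => y.
exists (submod_val subS y); apply: submod_val_inj.
by rewrite submod_liftE rK //; apply: submod_valP.
Qed.

Lemma retract_submod_projective (M : lmodType R) (S : M -> Prop)
    (subS : is_submodule S) (r : {linear M -> M}) :
  (forall x, S (r x)) -> (forall x, S x -> r x = x) ->
  projective M -> projective (submod subS).
Proof.
move=> rS rK.
apply: (projective_retract (i := submod_val subS) (r := submod_lift subS rS)).
move=> y; apply: submod_val_inj.
by rewrite submod_liftE rK //; apply: submod_valP.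
Qed.

Lemma cx_idempotents_split : idempotents_split cx.
Proof.
move=> X e ee.
have eK i x : cmap e i (cmap e i x) = cmap e i x.
  by rewrite -cmap_comp ee.
pose S i (x : deg X i) := cmap e i x = x.
have subS i : is_submodule (@S i).
  split; first exact: linear0.
  by move=> a x y xE yE; rewrite /S linearP xE yE.
have dS i x : S i x -> S _ (dif X i x) by move=> xE; rewrite /S cmap_dif xE.
have fgS i : finitely_generated (submod (subS i)).
  by apply: (@retract_submod_fg _ _ _ (cmap e i)) (deg_fg X i) => // x; apply: eK.
have projS i : projective (submod (subS i)).
  apply: (@retract_submod_projective _ _ _ (cmap e i)) (@deg_projective X i) => //.
  exact: eK.
have [r rE] := subcx_lift dS fgS projS (f := e) eK.
exists (subcx dS fgS projS), (subcx_incl dS fgS projS), r; split=> //.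
apply: cmapP => i x; apply: (@subcx_incl_inj _ _ subS dS fgS projS).
by rewrite -cmap_comp ccompA rE; apply: (@subcx_inclP _ S subS dS fgS projS).
Qed.

Lemma cx_additive : additive_category cx.
Proof.
move=> n A.
pose D i : lmodType R := dprod (fun j => deg (A j) i).
have d_lin i : linear (fun x : D i => (fun j => dif (A j) i (x j)) : D (ordS i)).
  by move=> a x y; apply: dprodP => j; rewrite linearP.
have fgD i : finitely_generated (D i).
  by apply: finitely_generated_dprod => j; apply: deg_fg.
have projD i : projective (D i).
  by apply: projective_dprod => j; apply: deg_projective.
have dd i x : mklin (d_lin (ordS i)) (mklin (d_lin i) x) = 0.
  by apply: dprodP => j /=; rewrite difK.
pose X := mkcx fgD projD dd.
have ud j i x : dprod_inj (fun j => deg (A j) (ordS i)) j (dif (A j) i x)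
    = mklin (d_lin i) (dprod_inj (fun j => deg (A j) i) j x).
  apply: dprodP => l /=; rewrite /dprod_inj_fun.
  have [<-|jl] := eqVneq j l; first by rewrite !dfwith_in.
  by rewrite !dfwith_out // linear0.
exists X, (fun j => @mkcmap (A j) X (fun i => dprod_inj (fun j => deg (A j) i) j) (ud j)).
exists (fun j => @mkcmap X (A j) (fun i => dprod_proj (fun j => deg (A j) i) j)
  (fun i x => erefl)).
split.
- by move=> j; apply: cmapP => i x; apply: (@dprod_injK _ _ (fun j => deg (A j) i)).
- move=> j l jl; apply: cmapP => i x.
  by apply: (@dprod_inj_out _ _ (fun j => deg (A j) i)); rewrite eq_sym.
- apply: cmapP => i x; rewrite cmap_sum cmap_id.
  exact/esym/(@dprod_split _ _ (fun j => deg (A j) i)).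
Qed.

End PeriodicComplexes.

(** ** The total module of a periodic complex *)

Section Total.
Variables (R : nzRingType) (m : nat).

Local Notation cx := (periodic_complexes (proj R) m).
Implicit Types X Y Z W : cx.

Definition tot X : lmodType R := dprod (deg X).

Definition tot_in X i : {linear deg X i -> tot X} := dprod_inj (deg X) i.
Definition tot_out X i : {linear tot X -> deg X i} := dprod_proj (deg X) i.

Lemma tot_fg X : finitely_generated (tot X).
Proof. by apply: finitely_generated_dprod => i; apply: deg_fg. Qed.

Lemma tot_projective X : projective (tot X).
Proof. by apply: projective_dprod => i; apply: deg_projective. Qed.

Lemma tot_map_linear X Y (f : hom X Y) :
  linear (fun x : tot X => (fun i => cmap f i (x i)) : tot Y).
Proof. by move=> a x y; apply: dprodP => i; rewrite linearP. Qed.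

Definition tot_map X Y (f : hom X Y) : linear_map (tot X) (tot Y) :=
  mklin (tot_map_linear f).

Lemma tot_d_linear X :
  linear (fun x : tot X => \sum_i tot_in X (ordS i) (dif X i (x i))).
Proof.
move=> a x y; rewrite scaler_sumr -big_split; apply: eq_bigr => i _ /=.
by rewrite dprodDE dprodZE linearP; apply: dprod_inj_linear.
Qed.

Definition tot_d X : linear_map (tot X) (tot X) := mklin (@tot_d_linear X).

Lemma tot_out_in X i x : tot_out X i (tot_in X i x) = x.
Proof. exact: (dprod_injK (F := deg X)). Qed.

Lemma tot_out_in_neq X i j x : i != j -> tot_out X j (tot_in X i x) = 0.
Proof. exact: (dprod_inj_out (F := deg X)). Qed.

Lemma tot_inP X x y : (forall i, tot_out X (ordS i) x = tot_out X (ordS i) y) -> x = y.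
Proof. by move=> xy; apply: dprodP => i; rewrite -(ord_predK i); apply: xy. Qed.

Lemma tot_ext X (M : lmodType R) (f g : {linear tot X -> M}) :
  (forall i x, f (tot_in X i x) = g (tot_in X i x)) -> forall x, f x = g x.
Proof.
move=> fg x; rewrite (dprod_split x) !linear_sum; apply: eq_bigr => i _.
exact: fg.
Qed.

Lemma tot_out_d X i x : tot_out X (ordS i) (tot_d X x) = dif X i (tot_out X i x).
Proof.
rewrite [LHS]linear_sum (bigD1 i) //= big1 => [|j ji].
  by rewrite addr0 [LHS](dprod_injK (F := deg X)).
by rewrite [LHS](dprod_inj_out (F := deg X)) // (inj_eq (@ordS_inj m)).
Qed.

Lemma tot_d_in X i x : tot_d X (tot_in X i x) = tot_in X (ordS i) (dif X i x).
Proof.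
apply: tot_inP => j; rewrite tot_out_d.
have [<-|ij] := eqVneq i j; first by rewrite !tot_out_in.
rewrite [tot_out X j _](dprod_inj_out (F := deg X)) // linear0.
by rewrite [RHS](dprod_inj_out (F := deg X)) // (inj_eq (@ordS_inj m)).
Qed.

Lemma tot_dd X x : tot_d X (tot_d X x) = 0.
Proof.
apply: tot_inP => j; rewrite tot_out_d -(ord_predK j).
by rewrite tot_out_d difK linear0.
Qed.

Lemma tot_out_map X Y (f : hom X Y) i x :
  tot_out Y i (tot_map f x) = cmap f i (tot_out X i x).
Proof. by []. Qed.

Lemma tot_map_in X Y (f : hom X Y) i x :
  tot_map f (tot_in X i x) = tot_in Y i (cmap f i x).
Proof.
apply: dprodP => j; transitivity (cmap f j (tot_out X j (tot_in X i x))) => //.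
have [<-|ij] := eqVneq i j.
  by rewrite tot_out_in; exact/esym/(@tot_out_in Y).
rewrite [tot_out X j _](dprod_inj_out (F := deg X)) // linear0.
exact/esym/(dprod_inj_out (F := deg Y) (cmap f i x) ij).
Qed.

Lemma tot_map_d X Y (f : hom X Y) x : tot_map f (tot_d X x) = tot_d Y (tot_map f x).
Proof.
by apply: tot_inP => i; rewrite tot_out_map !tot_out_d cmap_dif.
Qed.

Lemma tot_map_comp X Y Z (g : hom Y Z) (f : hom X Y) x :
  tot_map (g \o f) x = tot_map g (tot_map f x).
Proof. by []. Qed.

Lemma tot_map_inj X Y (f g : hom X Y) : tot_map f = tot_map g -> f = g.
Proof.
move=> fg; apply: cmapP => i x.
by rewrite -[x in LHS]tot_out_in -[x in RHS]tot_out_in -!tot_out_map fg.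
Qed.

(** For dualizing it is easier to work with maps of total modules that ignore the
  grading; this recovers chain maps from them. *)
Lemma diag_dif X Y (u : linear_map (tot X) (tot Y)) :
  (forall x, u (tot_d X x) = tot_d Y (u x)) ->
  exists f : hom X Y, forall i x, cmap f i x = tot_out Y i (u (tot_in X i x)).
Proof.
move=> ud.
have fd i x : (tot_out Y (ordS i) \o (u \o tot_in X (ordS i)))%FUN (dif X i x)
    = dif Y i ((tot_out Y i \o (u \o tot_in X i))%FUN x).
  transitivity (tot_out Y (ordS i) (u (tot_in X (ordS i) (dif X i x)))) => //.
  by rewrite -tot_d_in ud tot_out_d.
by exists (@mkcmap _ _ X Y (fun i => tot_out Y i \o (u \o tot_in X i))%FUN fd).
Qed.

End Total.

(** * Krull-Schmidt property *)

Section KrullSchmidt.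
Variables (k : fieldType) (H : falgType k) (m : nat).

Local Notation cx := (periodic_complexes (proj H) m).
Implicit Types X Y Z W : cx.

Lemma cscale_comm X Y c (f : hom X Y) i x :
  (c *: (cmap f (ordS i) : linear_map _ _)) (dif X i x)
  = dif Y i ((c *: (cmap f i : linear_map _ _)) x).
Proof. by rewrite !lmZE cmap_dif linearZ. Qed.

Definition cscale X Y c (f : hom X Y) : hom X Y :=
  @mkcmap _ _ X Y (fun i => c *: (cmap f i : linear_map _ _)) (cscale_comm c f).

Lemma cmap_scale X Y c (f : hom X Y) i x : cmap (cscale c f) i x = c%:A *: cmap f i x.
Proof. by []. Qed.

Lemma cscale_compl X Y Z c (g : hom Y Z) (f : hom X Y) :
  cscale c g \o f = cscale c (g \o f).
Proof. exact: cmapP. Qed.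

Lemma cscale_compr X Y Z c (g : hom Y Z) (f : hom X Y) :
  g \o cscale c f = cscale c (g \o f).
Proof. by apply: cmapP => i x; rewrite cmap_comp !cmap_scale linearZ. Qed.

Lemma embeddable_tot P X : finitely_generated P -> embeddable (linear_map P (tot X)).
Proof.
move=> fgP.
have [n [i [r ir]]] := fg_projective_retract (tot_fg X) (@tot_projective _ _ X).
exact: embeddable_hom fgP (can_inj ir).
Qed.

(** The powers of [h] lie in a finite dimensional space, so they are linearly
  dependent over [k]; solve a relation for the lowest power occurring in it. *)
Lemma cx_stabilizes X (h : hom X X) : stabilizes h.
Proof.
have [V [ev ev_inj]] := @embeddable_tot (tot X) X (tot_fg X).
pose N := (\dim {:V}).+1.
pose v := [tuple ev (tot_map (hpow h j)) | j < N].
have /freeP vN : ~~ free v.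
  apply/negP => /eqP v_free.
  have : (\dim <<v>> <= \dim {:V})%N by rewrite dimvS ?subvf.
  by rewrite v_free size_tuple ltnn.
have [c [c0 [j cj]]] : exists c : 'I_N -> k, \sum_(j < N) c j *: v`_j = 0
    /\ exists j, c j != 0.
  apply: contrapT => noc; apply: vN => c c0 j; apply/eqP; apply: contrapT => cj.
  by apply: noc; exists c; split=> //; exists j; apply/negP.
have {c0} c0 : \sum_(j < N) cscale (c j) (hpow h j) = 0.
  apply: tot_map_inj; apply: ev_inj.
  have -> : tot_map (\sum_(j < N) cscale (c j) (hpow h j))
      = \sum_(j < N) c j *: tot_map (hpow h j).
    apply: linear_map_ext => x; apply: dprodP => i.
    rewrite -[LHS]/(cmap _ i (x i)) cmap_sum.
    elim/big_rec2: _ => // l y f _ ->.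
    by rewrite lmDE dprodDE lmZE.
  rewrite linear_sum /=.
  have -> : tot_map (0 : hom X X) = 0.
    by apply: linear_map_ext => x; apply: dprodP.
  rewrite linear0 -[RHS]c0; apply: eq_bigr => l _.
  by rewrite linearZ -tnth_nth tnth_mktuple.
have [r cr r_min] := arg_minnP (P := fun l : 'I_N => c l != 0) (fun l => l : nat) cj.
have c_lt (l : 'I_N) : (l < r)%N -> c l = 0.
  by rewrite ltnNge; apply: contraNeq; apply: r_min.
pose b (l : 'I_N) := if (r < l)%N then - (c r)^-1 * c l else 0.
exists r, (\sum_(l < N) cscale (b l) (hpow h (l - r.+1))); split.
  rewrite ccomp_suml ccomp_sumr; apply: eq_bigr => l _.
  by rewrite cscale_compl cscale_compr [RHS]/(cscale _ _) -hpow_comm.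
apply: cmapP => i x; rewrite ccomp_sumr cmap_sum.
have sumD1 (F : 'I_N -> deg X i) : \sum_l F l = F r + \sum_(l | l != r) F l.
  by rewrite (bigD1 r).
have := congr1 (fun f : hom X X => cmap f i x) c0.
rewrite cmap_sum cmap0 sumD1 cmap_scale => /eqP; rewrite addr_eq0 => /eqP crE.
rewrite sumD1 cscale_compr cmap_scale.
have -> : b r = 0 by rewrite /b ltnn.
rewrite !scale0r add0r /b.
transitivity (\sum_(l < N | l != r)
  ((- (c r)^-1)%:A : H) *: cmap (cscale (c l) (hpow h l)) i x).
  rewrite -scaler_sumr -[X in _ *: X]opprK -crE scalerN scalerA -scalar_mul.
  by rewrite mulNr mulVf // scaleNr scale1r scaleN1r opprK.
apply: eq_bigr => l lr; rewrite cscale_compr !cmap_scale -hpowD scalerA -scalar_mul.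
case: ltnP => [r_lt_l|]; first by rewrite subnKC.
rewrite leq_eqVlt -val_eqE in lr *; rewrite (negbTE lr) => /c_lt ->.
by rewrite mulr0 !scale0r.
Qed.

(** Sizes are measured by injective [k]-linear maps into finite dimensional
  spaces, as these restrict to retracts. *)
Definition cx_dim X n := exists (V : vectType k) (f : tot X -> V),
  [/\ injective f, forall c x y, f (c%:A *: x + y) = c *: f x + f y &
      \dim {:V} = n].

Lemma cx_dim_ex X : exists n, cx_dim X n.
Proof.
have [n [i [r ir]]] := fg_projective_retract (tot_fg X) (@tot_projective _ _ X).
exists (\dim {:free_space H n}), (free_space H n), i.
by split=> [||//]; [apply: can_inj ir | move=> c x y; rewrite linearP free_spaceZ].
Qed.

(** An element [b] that the retraction kills allows dividing the target space by
  the line of [b]. *)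
Lemma cx_dim_drops : drops_on_retracts cx_dim.
Proof.
move=> X A i r n ri ir1 [V [f [f_inj f_lin <-]]].
have f0 : f 0 = 0.
  by have := f_lin (-1) 0 0; rewrite scaler0 addr0 scaleN1r addNr.
have [x0 x0P] : exists x, tot_map (i \o r) x <> x.
  apply: contrapT => nox; apply: ir1; apply: tot_map_inj.
  by apply: linear_map_ext => x; apply: contrapT => xP; apply: nox; exists x.
pose b := tot_map (i \o r) x0 - x0.
have rb : tot_map r b = 0.
  by rewrite linearB -tot_map_comp ccompA ri ccomp1m subrr.
have fb0 : f b != 0.
  by apply/eqP; rewrite -f0 => /f_inj /eqP; rewrite subr_eq0 => /eqP.
pose L := <[f b]>%VS.
pose p v := v - projv L v.
have p_lin c u v : p (c *: u + v) = c *: p u + p v.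
  by rewrite /p linearP opprD addrACA scalerBr.
have f_sub x y : f (x - y) = f x - f y.
  by rewrite addrC -scaleN1r -[in LHS](scale1r 1) -scaleNr f_lin scaleN1r addrC.
exists (\dim (L^C)).
  have := dim_vline (f b); rewrite fb0 => dimL.
  rewrite dimv_compl dimL ltn_subrL /=.
  by apply: leq_trans (dimvS (subvf L)); rewrite dimL.
exists (subvs_of (L^C)), (fun a => vsproj (L^C) (p (f (tot_map i a)))).
split=> [a a'||]; last by rewrite dimvf.
  move=> /(congr1 vsval); rewrite !vsprojK ?memv_projC // => paa'.
  have : p (f (tot_map i (a - a'))) = 0.
    by rewrite linearB f_sub addrC -scaleN1r p_lin paa' scaleN1r addNr.
  move=> /eqP; rewrite subr_eq0 => /eqP fE.
  have : f (tot_map i (a - a')) \in L by rewrite fE memv_proj.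
  case/vlineP => c; rewrite -[c *: f b]addr0 -f0 -f_lin => /f_inj.
  rewrite addr0 => iaE; apply/eqP; rewrite -subr_eq0; apply/eqP.
  transitivity (tot_map (r \o i) (a - a')); first by rewrite ri.
  by rewrite tot_map_comp iaE linearZ_LR rb scaler0.
by move=> c x y; rewrite linearP f_lin p_lin linearP.
Qed.

Theorem cx_krull_schmidt : krull_schmidt cx.
Proof.
apply: (krull_schmidt_of_dimension (@cx_idempotents_split _ m) cx_stabilizes
  cx_dim_ex cx_dim_drops).
exact: cx_additive.
Qed.

Lemma cx_local X : indecomposable X -> local_endo X.
Proof.
move=> indX; apply: local_endo_of_idempotents; [exact: cx_stabilizes | exact: indX.1 |].
move=> e; apply: indecomposable_idempotent indX.
exact: cx_idempotents_split.
Qed.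

End KrullSchmidt.

(** * The Nakayama dual of a projective module *)

Section FunctionalsOnAlgebra.
Variables (k : fieldType) (H : falgType k).

(** The [k]-dual [D H] of the right regular module. *)
Definition functionals := 'Hom(H, k^o).

HB.instance Definition _ := GRing.Zmodule.on functionals.

Implicit Types (f g : functionals) (h : H).

Definition functionals_scale h f : functionals := (f \o amulr h)%VF.

Lemma functionals_scaleE h f x : functionals_scale h f x = f (x * h).
Proof. by rewrite lfunE /= lfunE. Qed.

Lemma functionals_scaleA h h' f :
  functionals_scale h (functionals_scale h' f) = functionals_scale (h * h') f.
Proof. by apply/lfunP => x; rewrite !functionals_scaleE mulrA. Qed.

Lemma functionals_scale1 : left_id 1 functionals_scale.
Proof. by move=> f; apply/lfunP => x; rewrite functionals_scaleE mulr1. Qed.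

Lemma functionals_scaleDr : right_distributive functionals_scale +%R.
Proof.
move=> h f g; apply/lfunP => x.
by rewrite functionals_scaleE [LHS]add_lfunE [RHS]add_lfunE !functionals_scaleE.
Qed.

Lemma functionals_scaleDl f : {morph functionals_scale^~ f : h h' / h + h'}.
Proof.
move=> h h'; apply/lfunP => x.
by rewrite functionals_scaleE mulrDr linearD [RHS]add_lfunE !functionals_scaleE.
Qed.

HB.instance Definition _ := GRing.Zmodule_isLmodule.Build H functionals
  functionals_scaleA functionals_scale1 functionals_scaleDr functionals_scaleDl.

Lemma functionalsZE h f x : (h *: f) x = f (x * h).
Proof. exact: functionals_scaleE. Qed.

Lemma functionalsDE f g x : (f + g) x = f x + g x.
Proof. exact: add_lfunE. Qed.

Lemma functionals_sumE (I : finType) (F : I -> functionals) x :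
  (\sum_i F i) x = \sum_i F i x.
Proof.
elim/big_rec2: _ => [|i y f _ <-]; first exact: zero_lfunE.
by rewrite functionalsDE.
Qed.

Lemma finitely_generated_functionals : finitely_generated functionals.
Proof.
exists (\dim {: 'Hom(H, k^o)}), (fun l => (vbasis {: 'Hom(H, k^o)})`_l) => f.
exists (fun l => (coord (vbasis {: 'Hom(H, k^o)}) l f)%:A).
rewrite {1}(coord_vbasis (memvf (f : 'Hom(H, k^o)))); apply: eq_bigr => l _.
apply/lfunP => x; rewrite functionalsZE [LHS]scale_lfunE.
by rewrite mulr_algr linearZ.
Qed.

End FunctionalsOnAlgebra.

(** ** Duality between functionals on [Hom(P, W)] and maps out of [W] *)

Section Duality.
Variables (k : fieldType) (H : falgType k) (P : lmodType H) (n : nat).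
Variables (i : {linear P -> free_module H n}) (r : {linear free_module H n -> P}).
Hypothesis ir : cancel i r.
Implicit Types W : lmodType H.

Definition gen (l : 'I_n) : P := r [ffun l' => (l == l')%:R].

Lemma dual_basis (x : P) : x = \sum_l i x l *: gen l.
Proof.
rewrite -[LHS]ir [in LHS](free_sum (i x)) linear_sum.
by apply: eq_bigr => l _; rewrite linearZ.
Qed.

(** Along [i], the module [D Hom(P, H)] is a summand of [D(H)^n]: a functional [v]
  on [Hom(P, H)] has the coordinates [h |-> v(p_l h)], where [p_l] is the [l]-th
  coordinate of [i]. Since [D(H)^n] does not involve functionals on spaces of
  linear maps, it is used in place of its summand. *)
Definition nakayama : lmodType H := dprod (fun _ : 'I_n => functionals H).

Lemma finitely_generated_nakayama : finitely_generated nakayama.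
Proof.
by apply: finitely_generated_dprod => _; apply: finitely_generated_functionals.
Qed.

Lemma nakayamaP (v w : nakayama) : (forall l x, v l x = w l x) -> v = w.
Proof. by move=> vw; apply: dprodP => l; apply/lfunP => x. Qed.

Lemma rank_one_linear W l (h : H) (w : W) : linear (fun y => (i y l * h) *: w).
Proof. by move=> a x y; rewrite linearP !ffunE mulrDl scalerDl !scalerA mulrA. Qed.

(** The pure tensor of [p_l h] in [Hom(P, H)] and [w], as an element of
  [Hom(P, W)]. *)
Definition rank_one W l h (w : W) : linear_map P W := mklin (rank_one_linear l h w).

Lemma rank_oneE W l h (w : W) y : rank_one l h w y = (i y l * h) *: w.
Proof. by []. Qed.

Lemma rank_one_linear2 W l (w : W) : linear (fun h => rank_one l h w).
Proof.
move=> c h h'; apply: linear_map_ext => y.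
by rewrite lmDE lmZE !rank_oneE mulrDr scalerDl scalerA mulr_algl -scalerAr.
Qed.

Section Cotrace.
Variables (W : lmodType H) (s : {linear linear_map P W -> k^o}).

Lemma cotrace_linear1 l w : linear (fun h => s (rank_one l h w)).
Proof. by move=> c h h'; rewrite rank_one_linear2 linearP. Qed.

(** The image of [s] under [D Hom(P, W) = Hom(W, D Hom(P, H))]. *)
Definition cotrace_fun w : nakayama := fun l => linfun (mklin (cotrace_linear1 l w)).

Lemma cotrace_funE w l h : cotrace_fun w l h = s (rank_one l h w).
Proof. by rewrite lfunE. Qed.

Lemma cotrace_linear : linear cotrace_fun.
Proof.
move=> a x y; apply: nakayamaP => l h.
rewrite dprodDE functionalsDE dprodZE functionalsZE !cotrace_funE -linearD.
congr (s _); apply: linear_map_ext => z.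
by rewrite lmDE !rank_oneE scalerDr scalerA mulrA.
Qed.

Definition cotrace : {linear W -> nakayama} := mklin cotrace_linear.

Lemma cotraceE w l h : cotrace w l h = s (rank_one l h w).
Proof. exact: cotrace_funE. Qed.

End Cotrace.

(** The functional on [Hom(P, W)] that belongs to [s], the inverse of [cotrace]. *)
Definition trace_pair W (s : W -> nakayama) (u : P -> W) : k :=
  \sum_l s (u (gen l)) l 1.

Lemma trace_pair_cotrace W (s : {linear linear_map P W -> k^o}) (u : linear_map P W) :
  trace_pair (cotrace s) u = s u.
Proof.
transitivity (s (\sum_l rank_one l 1 (u (gen l)))).
  by rewrite linear_sum; apply: eq_bigr => l _; rewrite cotraceE.
congr (s _); apply: linear_map_ext => y.
transitivity (\sum_l rank_one l 1 (u (gen l)) y).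
  by elim/big_rec2: _ => // l z f _ <-.
rewrite [in RHS](dual_basis y) linear_sum; apply: eq_bigr => l _.
by rewrite /= mulr1 linearZ.
Qed.

Section Codual.
Variable d : linear_map P P.

(** The transpose of composition with [d] on [Hom(P, H)], in coordinates:
  [p_l h d] is the sum over [l'] of [p_l' (p_l(d(gen l')) h)]. *)
Definition codual_val (v : nakayama) l (h : H) : k^o :=
  \sum_l' v l' (i (d (gen l')) l * h).

Lemma codual_linear1 (v : nakayama) l : linear (codual_val v l).
Proof.
move=> c h h'; rewrite /codual_val scaler_sumr -big_split; apply: eq_bigr => l' _ /=.
by rewrite mulrDr -scalerAr linearP.
Qed.

Definition codual_fun (v : nakayama) : nakayama :=
  fun l => linfun (mklin (codual_linear1 v l)).

Lemma codual_funE v l h :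
  codual_fun v l h = \sum_l' v l' (i (d (gen l')) l * h).
Proof. by rewrite lfunE. Qed.

Lemma codual_linear : linear codual_fun.
Proof.
move=> a v w; apply: nakayamaP => l h.
rewrite dprodDE functionalsDE dprodZE functionalsZE !codual_funE -big_split.
apply: eq_bigr => l' _ /=.
by rewrite dprodDE functionalsDE dprodZE functionalsZE mulrA.
Qed.

Definition codual : {linear nakayama -> nakayama} := mklin codual_linear.

Lemma codualE v l h : codual v l h = \sum_l' v l' (i (d (gen l')) l * h).
Proof. exact: codual_funE. Qed.

Lemma dual_basis_d y l : i (d y) l = \sum_l' i y l' * i (d (gen l')) l.
Proof.
rewrite {1}(dual_basis y) !linear_sum sum_ffunE; apply: eq_bigr => l' _.
by rewrite !linearZ ffunE.
Qed.

Lemma codual_cotrace W (s t : {linear linear_map P W -> k^o}) :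
  (forall u, t u = s (lm_comp u d)) ->
  forall w, codual (cotrace s w) = cotrace t w.
Proof.
move=> tE w; apply: nakayamaP => l h; rewrite codualE cotraceE tE.
transitivity (s (\sum_l' rank_one l' (i (d (gen l')) l * h) w)).
  by rewrite linear_sum; apply: eq_bigr => l' _; rewrite cotraceE.
congr (s _); apply: linear_map_ext => y.
transitivity (\sum_l' rank_one l' (i (d (gen l')) l * h) w y).
  by elim/big_rec2: _ => // l' z f _ <-.
rewrite /= dual_basis_d mulr_suml scaler_suml.
by apply: eq_bigr => l' _; rewrite mulrA.
Qed.

Lemma trace_pair_codual W (s : {linear W -> nakayama}) (u : linear_map P W) :
  trace_pair (fun w => codual (s w)) u = trace_pair s (fun x => u (d x)).
Proof.
rewrite /trace_pair; under eq_bigr do rewrite codualE.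
rewrite exchange_big /=; apply: eq_bigr => l' _.
rewrite [in RHS](dual_basis (d (gen l'))) !linear_sum.
rewrite dprod_sumE functionals_sumE; apply: eq_bigr => l _.
by rewrite !linearZ_LR dprodZE functionalsZE mul1r mulr1.
Qed.

Lemma codualK (v : nakayama) : (forall x, d (d x) = 0) -> codual (codual v) = 0.
Proof.
move=> dd; apply: nakayamaP => l h; rewrite codualE.
under eq_bigr do rewrite codualE.
rewrite exchange_big [RHS]lfunE /= big1 // => l' _.
rewrite -linear_sum; under eq_bigr do rewrite mulrA.
by rewrite -mulr_suml -dual_basis_d dd linear0 ffunE mul0r linear0.
Qed.

End Codual.

End Duality.

(** * Almost split sequences from sink morphisms *)

Section TwistedSum.
Variables (R : nzRingType) (m : nat).

Local Notation cx := (periodic_complexes (proj R) m).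

Variables (W Z : cx) (t : forall i, {linear deg Z i -> deg W (ordS i)}).
Hypothesis td : forall i z, dif W (ordS i) (t i z) + t (ordS i) (dif Z i z) = 0.

Lemma twisted_d_linear i : linear (fun x : (deg W i * deg Z i)%type =>
  (dif W i x.1 + t i x.2, dif Z i x.2) : (deg W (ordS i) * deg Z (ordS i))%type).
Proof.
move=> a x y; congr (_, _) => /=; last by rewrite linearP.
by rewrite !linearP /= scalerDr addrACA.
Qed.

Definition twisted_d i := mklin (@twisted_d_linear i).

Lemma twisted_dd i x : twisted_d (ordS i) (twisted_d i x) = 0.
Proof.
by congr (_, _); rewrite /= ?difK // linearD difK add0r td.
Qed.

(** The extension of [Z] by [W] classified by [t], a chain map from [Z] to the
  shift of [W]; the hypothesis [td] incorporates the sign of the shift. *)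
Definition twisted : cx := mkcx
  (fun i => finitely_generated_pair (deg_fg W i) (deg_fg Z i))
  (fun i => projective_pair (@deg_projective _ _ W i) (@deg_projective _ _ Z i))
  twisted_dd.

Lemma twisted_in_comm i w : pair_inl (deg W (ordS i)) (deg Z (ordS i)) (dif W i w)
  = dif twisted i (pair_inl (deg W i) (deg Z i) w).
Proof. by congr (_, _); rewrite /= linear0 ?addr0. Qed.

Definition twisted_in : hom W twisted :=
  @mkcmap R m W twisted (fun i => pair_inl (deg W i) (deg Z i)) twisted_in_comm.

Definition twisted_out : hom twisted Z :=
  @mkcmap R m twisted Z (fun i => snd : {linear (deg W i * deg Z i)%type -> deg Z i})
    (fun i x => erefl).

End TwistedSum.

Section Deflation.
Variables (R : nzRingType) (m : nat).

Local Notation cx := (periodic_complexes (proj R) m).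
Implicit Types W X Y Z : cx.

Definition degreewise_surjective X Y (g : hom X Y) :=
  forall i y, exists x, cmap g i x = y.

Variables (Y Z : cx) (g : hom Y Z).
Hypothesis g_surj : degreewise_surjective g.

(** The degreewise retractions [rho] and sections [s] are recorded because they
  give the cocycle of the conflation, from which its pushouts are built. *)
Lemma deflation_kernel : exists (X : cx) (f : hom X Y)
    (rho : forall i, {linear deg Y i -> deg X i})
    (s : forall i, {linear deg Z i -> deg Y i}),
  [/\ forall i, injective (cmap f i), forall i z, cmap g i (s i z) = z,
      forall i x, cmap g i (cmap f i x) = 0,
      forall i y, cmap f i (rho i y) = y - s i (cmap g i y) &
      forall W (h : hom W Y), g \o h = 0 -> exists h', f \o h' = h].
Proof.
have [s sK] := dependent_choice (fun i =>
  projective_section (@deg_projective _ _ Z i) (g_surj (i := i))).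
pose S i (y : deg Y i) := cmap g i y = 0.
have subS i : is_submodule (@S i).
  split=> [|a x y x0 y0]; first exact: linear0.
  by rewrite /S linearP x0 y0 scaler0 addr0.
have dS i y : S i y -> S _ (dif Y i y) by move=> y0; rewrite /S cmap_dif y0 linear0.
have q_lin i : linear (fun y => y - s i (cmap g i y)).
  by move=> a x y; rewrite [cmap g i _]linearP [s i _]linearP scalerBr opprD addrACA.
pose q i : {linear deg Y i -> deg Y i} := mklin (q_lin i).
have qS i y : S i (q i y) by rewrite /S /q /= linearB /= sK subrr.
have qK i y : S i y -> q i y = y by move=> y0; rewrite /q /= y0 linear0 subr0.
have fgS i := retract_submod_fg (subS i) (qS i) (qK i) (deg_fg Y i).
have projS i := @retract_submod_projective _ _ _ (subS i) (q i) (qS i) (qK i)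
  (@deg_projective _ _ Y i).
exists (subcx dS fgS projS), (subcx_incl dS fgS projS).
exists (fun i => submod_lift (subS i) (qS i)), s; split=> //.
- by move=> i; apply: subcx_incl_inj.
- by move=> i x; apply: (@subcx_inclP _ _ _ S subS dS fgS projS).
- move=> W h gh; apply: subcx_lift => i w.
  by rewrite /S -cmap_comp gh.
Qed.

(** A pushout of the conflation along [h : X -> W] is the extension of [Z] by [W]
  classified by [h rho d s], because [rho d s] classifies [Y] itself. *)
Lemma almost_split_of_sink : local_endo Z -> sink g ->
  exists (X : cx) (f : hom X Y),
    almost_split_sequence (@degreewise_split (proj R) m) f g.
Proof.
move=> locZ g_sink.
have [X [f [rho [s [f_inj gs gf frho ker]]]]] := deflation_kernel.
have rhof i x : rho i (cmap f i x) = x.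
  by apply: f_inj; rewrite frho gf linear0 subr0.
have gf0 : g \o f = 0 by apply: cmapP => i x; rewrite cmap_comp gf.
exists X, f; split=> // [i|].
  exists (rho i), (s i); split; apply: linear_map_ext => x.
  - exact: rhof.
  - exact: gs.
  - exact: gf.
  - apply: f_inj; rewrite linear0; transitivity (s i x - s i (cmap g i (s i x))).
      exact: frho.
    by rewrite gs subrr.
  - transitivity (cmap f i (rho i x) + s i (cmap g i x)) => //.
    by rewrite frho subrK.
apply: (source_of_sink locZ g_sink).
- by split=> // W u v fuv; apply: cmapP => i w; apply: f_inj; rewrite -!cmap_comp fuv.
- split=> [W u v uv|W h hf].
    by apply: cmapP => i z; rewrite -[z]gs -!cmap_comp uv.
  have hsg i y : cmap h i (s i (cmap g i y)) = cmap h i y.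
    apply/eqP; rewrite eq_sym -subr_eq0 -linearB -frho.
    by rewrite -cmap_comp hf.
  have hs_d i z : (cmap h (ordS i) \o s (ordS i))%FUN (dif Z i z)
      = dif W i ((cmap h i \o s i)%FUN z).
    by rewrite /= -cmap_dif -[in LHS](gs i z) -cmap_dif hsg.
  exists (@mkcmap R m Z W (fun i => cmap h i \o s i)%FUN hs_d).
  by apply: cmapP => i y; apply: hsg.
- move=> W h.
  pose t i : {linear deg Z i -> deg W (ordS i)} :=
    (cmap h (ordS i) \o (rho (ordS i) \o (dif Y i \o s i)))%FUN.
  have td i z : dif W (ordS i) (t i z) + t (ordS i) (dif Z i z) = 0.
    rewrite /t /= -cmap_dif -linearD.
    apply: (etrans _ (linear0 (cmap h (ordS (ordS i))))); congr (cmap h _ _).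
    apply: f_inj; rewrite linear0 linearD cmap_dif !frho !cmap_dif !gs.
    by rewrite [dif Y (ordS i) (_ - _)]linearB /= !difK sub0r linear0 subr0 addNr.
  have y_lin i : linear (fun y => (cmap h i (rho i y), cmap g i y)
      : (deg W i * deg Z i)%type).
    by move=> a x y; congr (_, _); rewrite /= !linearP.
  have yd i y : mklin (y_lin (ordS i)) (dif Y i y)
      = dif (twisted td) i (mklin (y_lin i) y).
    congr (_, _) => /=; last exact: cmap_dif.
    rewrite /t /= -cmap_dif -linearD; congr (cmap h _ _).
    apply: f_inj; rewrite linearD cmap_dif !frho !cmap_dif !gs linearB.
    by rewrite addrA subrK.
  exists (twisted td), (twisted_in td), (twisted_out td).
  exists (@mkcmap R m Y (twisted td) (fun i => mklin (y_lin i)) yd); split.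
  - by apply: cmapP => i x; congr (_, _) => /=; rewrite ?rhof ?gf.
  - exact: cmapP.
  - split.
    + exact: cmapP.
    + move=> V u v uv; apply: cmapP => i x.
      by have /(congr1 fst) := congr1 (fun w : hom V (twisted td) => cmap w i x) uv.
    + move=> V v v0.
      have v2 i x : (cmap v i x).2 = 0.
        exact: (congr1 (fun w : hom V Z => cmap w i x) v0).
      have v1_d i x : (fst \o cmap v (ordS i))%FUN (dif V i x)
          = dif W i ((fst \o cmap v i)%FUN x).
        transitivity (dif W i (cmap v i x).1 + t i (cmap v i x).2).
          exact: (congr1 fst (cmap_dif v x)).
        by rewrite v2 linear0 addr0.
      exists (@mkcmap R m V W (fun i => fst \o cmap v i)%FUN v1_d).
      by apply: cmapP => i x; rewrite [RHS]surjective_pairing v2.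
Qed.

End Deflation.

(** * Contractible complexes *)

Section Contractible.
Variables (R : nzRingType) (m : nat).

Local Notation cx := (periodic_complexes (proj R) m).
Implicit Types W X Y Z : cx.

Definition contractible Z :=
  exists t : forall i, {linear deg Z (ordS i) -> deg Z i},
    forall i z, z = dif Z i (t i z) + t (ordS i) (dif Z (ordS i) z).

(** A contracting homotopy produces components in the successor degrees only; as
  [ordS] is bijective, these make up a family over all degrees. *)
Lemma ordS_family (F : 'I_m -> Type) (f : forall i, F (ordS i)) :
  exists g : forall i, F i, forall i, g (ordS i) = f i.
Proof.
suff /dependent_choice [g gP] : forall j, exists x : F j,
    forall i (e : ordS i = j), x = ecast j (F j) e (f i).
  by exists g => i; rewrite (gP (ordS i) i erefl).
move=> j; rewrite -(ord_predK j); exists (f (ord_pred j)) => i e.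
have ij := ordS_inj e; case: _ / ij in e *.
by rewrite eq_axiomK.
Qed.

Lemma ordS_ind (P : 'I_m -> Prop) : (forall i, P (ordS i)) -> forall i, P i.
Proof. by move=> PS i; rewrite -(ord_predK i). Qed.

(** Correct degreewise sections [s] of [h] to [d s t + s t d], which commutes with
  the differentials; it is a section of [h] because [d t + t d = 1]. *)
Lemma contractible_split_epi W Z (h : hom W Z) :
  contractible Z -> degreewise_surjective h -> split_epi h.
Proof.
move=> [t tE] h_surj.
have [s sK] := dependent_choice (fun i =>
  projective_section (@deg_projective _ _ Z i) (h_surj i)).
pose f i : {linear deg Z (ordS i) -> deg W (ordS i)} :=
  ((dif W i \o (s i \o t i)) \+ (s (ordS i) \o (t (ordS i) \o dif Z (ordS i))))%FUN.
have [g gE] := @ordS_family (fun i => {linear deg Z i -> deg W i}) f.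
have gd i z : g (ordS i) (dif Z i z) = dif W i (g i z).
  move: i z; apply: ordS_ind => i z.
  by rewrite !gE /f /= !difK !linear0 addr0 linearD difK add0r.
exists (@mkcmap R m Z W g gd).
apply: cmapP; apply: ordS_ind => i z.
rewrite cmap_comp mkcmapE gE cmap_id [RHS]tE /f /= linearD cmap_dif.
by congr (dif Z i _ + _); apply: sK.
Qed.

(** ** The sum of two non-split maps to a local object *)

Lemma non_split_epi_sum Z W1 W2 (h1 : hom W1 Z) (h2 : hom W2 Z) :
  local_endo Z -> ~ split_epi h1 -> ~ split_epi h2 ->
  exists W (h : hom W Z), ~ split_epi h /\
    forall w1 w2, exists w, tot_map h w = tot_map h1 w1 + tot_map h2 w2.
Proof.
move=> [_ locZ] h1N h2N.
have t0 i z : dif W1 (ordS i) ((\0 : {linear deg W2 i -> deg W1 (ordS i)}) z)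
    + (\0 : {linear deg W2 (ordS i) -> _}) (dif W2 i z) = 0.
  by rewrite /= linear0 addr0.
pose W := twisted t0.
have p1_d i (x : deg W i) : (dif W i x).1 = dif W1 i x.1 by rewrite /= addr0.
pose p1 : hom W W1 := @mkcmap R m W W1
  (fun i => fst : {linear (deg W1 i * deg W2 i)%type -> deg W1 i}) p1_d.
pose p2 : hom W W2 := twisted_out t0.
exists W, ((h1 \o p1) + (h2 \o p2)); split.
  case=> s; rewrite ccompDl -!ccompA => sE.
  apply: (locZ (h1 \o (p1 \o s)) (h2 \o (p2 \o s))); try exact: non_split_epi_comp.
  by rewrite sE; exists (idm Z); rewrite ccomp1m.
move=> w1 w2; exists (fun i => (w1 i, w2 i)).
exact: dprodP.
Qed.

End Contractible.

Section HereditaryContractible.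
Variables (k : fieldType) (H : falgType k) (m : nat).
Hypothesis herH : hereditary H.

Local Notation cx := (periodic_complexes (proj H) m).
Implicit Types W X Y Z : cx.

Lemma submod_embedding (M : lmodType H) (S : M -> Prop) (subS : is_submodule S) :
  finitely_generated M -> projective M ->
  exists n (i : {linear submod subS -> free_module H n}), injective i.
Proof.
move=> fgM projM; have [n [i [r ir]]] := fg_projective_retract fgM projM.
exists n, (i \o submod_val subS)%FUN => x y /(can_inj ir).
exact: submod_val_inj.
Qed.

Lemma finitely_generated_submod (M : lmodType H) (S : M -> Prop)
    (subS : is_submodule S) :
  finitely_generated M -> projective M -> finitely_generated (submod subS).
Proof.
move=> fgM projM; have [n [i i_inj]] := submod_embedding subS fgM projM.
exact: finitely_generated_of_embedding i_inj.
Qed.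

Lemma projective_submod (M : lmodType H) (S : M -> Prop) (subS : is_submodule S) :
  finitely_generated M -> projective M -> projective (submod subS).
Proof.
move=> fgM projM; have [n [i i_inj]] := submod_embedding subS fgM projM.
exact: hereditary_projective i_inj.
Qed.

(** The elements hit by non-split maps into [Z] form a subcomplex, by locality.
  If it were all of [Z], finitely many of these maps would together be
  surjective, hence split as [Z] is contractible. *)
Lemma pseudo_projective_of_contractible Z :
  indecomposable Z -> contractible Z -> pseudo_projective Z.
Proof.
move=> /cx_local locZ contrZ.
pose T (x : tot Z) := exists W (h : hom W Z) w, ~ split_epi h /\ tot_map h w = x.
have T0 : T 0.
  exists Z, 0, 0; split; last exact: linear0.
  by case=> s; rewrite ccomp0m => /esym; apply: locZ.1.
have subT : is_submodule T.
  split=> // a _ _ [W1 [h1 [w1 [h1N <-]]]] [W2 [h2 [w2 [h2N <-]]]].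
  have [W [h [hN hE]]] := non_split_epi_sum locZ h1N h2N.
  have [w wE] := hE (a *: w1) w2.
  by exists W, h, w; split=> //; rewrite wE linearZ.
pose S i x := T (tot_in Z i x).
have subS i : is_submodule (@S i) by apply: is_submodule_preim.
have dS i x : S i x -> S _ (dif Z i x).
  move=> [W [h [w [hN hw]]]]; exists W, h, (tot_d W w); split=> //.
  by rewrite tot_map_d hw tot_d_in.
have fgS i := finitely_generated_submod (subS i) (deg_fg Z i) (@deg_projective _ _ Z i).
have projS i := @projective_submod _ _ (subS i) (deg_fg Z i) (@deg_projective _ _ Z i).
have incl_inj := @subcx_incl_inj _ _ _ _ subS dS fgS projS.
have incl_mono : mono (subcx_incl dS fgS projS).
  move=> W u v uv; apply: cmapP => i w; apply: incl_inj.
  by rewrite -!cmap_comp uv.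
exists (subcx dS fgS projS), (subcx_incl dS fgS projS); split=> //; split.
  move=> h hE; have -> : h = idm _ by apply: incl_mono; rewrite hE ccompm1.
  by exists (idm _); rewrite ccomp1m.
split=> [[s sE]|W h hN]; last first.
  apply: subcx_lift => i w; exists W, h, (tot_in W i w); split=> //.
  exact: tot_map_in.
have allT x : T x.
  rewrite (dprod_split x); elim/big_rec: _ => // i y _ Ty.
  apply: is_submoduleD => //.
  have : S i (cmap (subcx_incl dS fgS projS \o s) i (x i)).
    exact: subcx_inclP.
  by rewrite sE.
have [gens gensP] := (finitely_generatedP (tot Z)).1 (tot_fg Z).
have [W [h [hN hgens]]] : exists W (h : hom W Z), ~ split_epi h /\
    forall x, x \in gens -> exists w, tot_map h w = x.
  elim: gens {gensP} => [|x s' [W1 [h1 [h1N h1s]]]].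
    by have [W [h [w [hN _]]]] := T0; exists W, h.
  have [W2 [h2 [w2 [h2N h2x]]]] := allT x.
  have [W [h [hN hE]]] := non_split_epi_sum locZ h1N h2N.
  exists W, h; split=> // y; rewrite inE => /predU1P [-> | ys].
    by have [w wE] := hE 0 w2; exists w; rewrite wE linear0 add0r.
  have [w1 <-] := h1s y ys; have [w wE] := hE w1 0.
  by exists w; rewrite wE linear0 addr0.
have h_surj x : exists w, tot_map h w = x.
  apply: (gensP (fun x => exists w, tot_map h w = x)) => //.
  split; first by exists 0; rewrite linear0.
  by move=> a _ _ [w <-] [w' <-]; exists (a *: w + w'); rewrite linearP.
apply: hN; apply: contractible_split_epi => // i z.
have [w wE] := h_surj (tot_in Z i z).
by exists (tot_out W i w); rewrite -tot_out_map wE tot_out_in.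
Qed.

End HereditaryContractible.

(** * Right almost split morphisms to non-contractible complexes *)

Section NonContractible.
Variables (k : fieldType) (H : falgType k) (m : nat).

Local Notation cx := (periodic_complexes (proj H) m).
Implicit Types W X Y Z : cx.

Section Functional.
Variable Z : cx.
Hypotheses (locZ : local_endo Z) (ncZ : ~ contractible Z).
Let P := tot Z.
Let d : linear_map P P := tot_d Z.

(** The radical endomorphisms modulo homotopy, extended by all the maps without
  degree preserving part: killing the latter makes a functional on all linear
  maps behave like one on chain maps. *)
Definition radical_map (u : linear_map P P) := exists (c : hom Z Z) (t : linear_map P P),
  ~ is_iso c /\ forall i x, tot_out Z i (u (tot_in Z i x))
    = cmap c i x + tot_out Z i (d (t (tot_in Z i x)) + t (d (tot_in Z i x))).

Lemma not_iso0 : ~ is_iso (0 : hom Z Z).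
Proof. by case=> u [_]; rewrite ccomp0m => /esym; apply: locZ.1. Qed.

Lemma radical_map_subspace : subspace radical_map.
Proof.
split.
  exists 0, 0; split=> [|i x]; first exact: not_iso0.
  by rewrite cmap0 add0r !linear0 addr0 linear0.
move=> a u v [c [t [cN uE]]] [c' [t' [c'N vE]]].
exists (cscale a c + c'), (a *: t + t'); split.
  apply: locZ.2 => // -[w [wc cw]]; apply: cN; exists (cscale a w).
  by move: wc cw; rewrite !cscale_compl !cscale_compr.
move=> i x; rewrite cmapD cmap_scale !lmDE !lmZE.
rewrite [LHS]linearP uE vE scalerDr addrACA; congr (_ + _).
by rewrite [d (_ + _)]linearP addrACA -scalerDr [RHS]linearP.
Qed.

(** Otherwise some [1 - c] would be null-homotopic with [c] not invertible; by
  locality [1 - c] is invertible, and [Z] would be contractible. *)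
Lemma radical_map_idm : ~ radical_map (lm_id P).
Proof.
move=> [c [t [cN idE]]]; apply: ncZ.
have tE i x : cmap (idm Z - c) i x
    = tot_out Z i (d (t (tot_in Z i x)) + t (d (tot_in Z i x))).
  by rewrite cmapB cmap_id -{1}[x]tot_out_in [tot_out Z i _]idE addrC addKr.
have [v [vu _]] : is_iso (idm Z - c).
  apply: contrapT => uN; apply: (locZ.2 c (idm Z - c)) => //.
  by rewrite addrC subrK; exists (idm Z); rewrite ccomp1m.
exists (fun i => cmap v i \o (tot_out Z i \o (t \o tot_in Z (ordS i))))%FUN => i z.
rewrite -[LHS](cmap_id (X := Z)) -vu cmap_comp tE.
by rewrite [tot_out _ _ _]linearD [LHS]linearD tot_out_d cmap_dif tot_d_in.
Qed.

(** A functional that detects the simple top of the functor [Hom(-, Z)], modulo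
  homotopy. *)
Lemma radical_functional : exists f : {linear linear_map P P -> k^o},
  [/\ f (lm_id P) = 1, forall t, f (lm_comp d t + lm_comp t d) = 0 &
      forall W (h : hom W Z) (u : linear_map P (tot W)), ~ split_epi h ->
        (forall x, u (d x) = tot_d W (u x)) -> f (lm_comp (tot_map h) u) = 0].
Proof.
have embP : embeddable (linear_map P P) by apply: embeddable_tot; apply: tot_fg.
have [f [fS f1]] := functional_separating embP radical_map_subspace radical_map_idm.
exists f; split=> // [t|W h u hN ud]; apply: fS.
  by exists 0, t; split; [apply: not_iso0 | move=> i x; rewrite cmap0 add0r].
have [c cE] := diag_dif ud.
exists (h \o c), 0; split; first exact: non_split_epi_comp.
move=> i x; rewrite !linear0 addr0 linear0 addr0 cmap_comp cE.
by rewrite -tot_out_map.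
Qed.

End Functional.

Section Hereditary.
Hypothesis herH : hereditary H.

(** Write [theta : tot Z -> N] for the map to the Nakayama dual [N] of [tot Z]
  that corresponds to the functional [f], and [pi : G -> N] for a free cover. The
  triples [(z, g, g')] with [pi g' = theta z + codual (pi g)] form a complex of
  projectives; it is a resolution of the cocone of [theta], and a map to [Z]
  lifts to it as soon as its composite with [theta] is null-homotopic. *)
Lemma right_almost_split_ex Z : local_endo Z -> ~ contractible Z ->
  exists Y (g : hom Y Z), right_almost_split g /\ degreewise_surjective g.
Proof.
move=> locZ ncZ.
have [f [f1 f_homotopy f_rad]] := radical_functional locZ ncZ.
set P := tot Z in f f1 f_homotopy f_rad; set d := tot_d Z in f_homotopy f_rad.
have [n [i [r ir]]] := fg_projective_retract (tot_fg Z) (@tot_projective _ _ Z).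
pose N := nakayama H n.
pose theta : {linear P -> N} := cotrace i f.
pose codual_d : {linear N -> N} := codual i r d.
have codual_theta z : codual_d (theta z) = - theta (d z).
  have fd_lin : linear (fun u : linear_map P P => f (lm_comp u d)).
    by move=> a u v; rewrite -[RHS]linearP; congr (f _); apply: linear_map_ext.
  rewrite (codual_cotrace ir (t := mklin fd_lin)) //.
  apply/eqP; rewrite -addr_eq0; apply/eqP; apply: nakayamaP => l x.
  rewrite dprodDE functionalsDE !cotraceE /= -linearD [RHS]lfunE /=.
  rewrite -[RHS](f_homotopy (rank_one i l x z)) addrC; congr (f (_ + _)).
  by apply: linear_map_ext => y; apply: esym (linearZ_LR d _ _).
have codual_dd v : codual_d (codual_d v) = 0.
  by apply: codualK => // x; apply: tot_dd.
have [N' [pi pi_surj]] := finitely_generated_cover (finitely_generated_nakayama H n).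
pose G := free_module H N'.
pose A j : lmodType H := (deg Z j * (G * G))%type.
have dA_lin j : linear (fun x : A j => (dif Z j x.1, (x.2.2, 0)) : A (ordS j)).
  by move=> a x y; congr (_, (_, _)); rewrite /= ?linearP // scaler0 addr0.
have fgA j : finitely_generated (A j).
  apply: finitely_generated_pair (deg_fg Z j) _.
  by apply: finitely_generated_pair; apply: finitely_generated_free.
have projA j : projective (A j).
  apply: projective_pair (@deg_projective _ _ Z j) _.
  by apply: projective_pair; apply: projective_free.
have ddA j x : mklin (dA_lin (ordS j)) (mklin (dA_lin j) x) = 0.
  by congr (_, (_, _)); rewrite /= difK.
pose cA := mkcx fgA projA ddA.
pose S j (x : deg cA j) := pi x.2.2 = theta (tot_in Z j x.1) + codual_d (pi x.2.1).
have subS j : is_submodule (@S j).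
  split; first by rewrite /S !linear0 addr0.
  by move=> a x y xE yE; rewrite /S !linearP /= xE yE scalerDr addrACA.
have dS j x : S j x -> S _ (dif cA j x).
  move=> xE.
  change (pi 0 = theta (tot_in Z _ (dif Z j x.1)) + codual_d (pi x.2.2)).
  rewrite linear0 xE [codual_d (_ + _)]linearD codual_theta codual_dd addr0.
  by rewrite tot_d_in addrC addNr.
have fgS j := finitely_generated_submod (subS j) (deg_fg cA j) (@deg_projective _ _ cA j).
have projS j := @projective_submod _ _ herH _ _ (subS j) (deg_fg cA j)
  (@deg_projective _ _ cA j).
pose Y := subcx dS fgS projS; pose incl : hom Y cA := subcx_incl dS fgS projS.
pose p : hom cA Z := @mkcmap H m cA Z
  (fun j => fst : {linear (deg Z j * (G * G))%type -> deg Z j}) (fun j x => erefl).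
have p_incl_surj : degreewise_surjective (p \o incl).
  move=> j z; have [g' g'E] := pi_surj (theta (tot_in Z j z)).
  have : S j (z, (0, g')).
    change (pi g' = theta (tot_in Z j z) + codual_d (pi 0)).
    by rewrite g'E !linear0 addr0.
  by case/(subcx_in dS fgS projS) => y yE; exists y; rewrite cmap_comp yE.
exists Y, (p \o incl); split=> //; split=> [[s sE]|W h hN].
  (* The second component [e] of a section would make [theta] null-homotopic:
     [e d = theta + codual_d e]. Pairing with the identity gives [f 1 = 0]. *)
  pose v j : {linear deg Z j -> A j} := (cmap incl j \o cmap s j)%FUN.
  have v1 j z : (v j z).1 = z.
    exact: (congr1 (fun u : hom Z Z => cmap u j z) sE).
  have v_dif j z : (v (ordS j) (dif Z j z)).2.1 = (v j z).2.2.
    exact: (congr1 (fun x => x.2.1) (cmap_dif (incl \o s) z)).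
  have vS j z : pi (v j z).2.2 = theta (tot_in Z j z) + codual_d (pi (v j z).2.1).
    by rewrite -{2}(v1 j z); apply: (@subcx_inclP _ _ cA S subS dS fgS projS).
  have e_lin : linear (fun x : P => \sum_j pi (v j (x j)).2.1).
    move=> a x y; rewrite scaler_sumr -big_split; apply: eq_bigr => j _.
    by rewrite dprodDE dprodZE [v j _]linearP [LHS]linearP.
  pose e : {linear P -> N} := mklin e_lin.
  have e_in j z : e (tot_in Z j z) = pi (v j z).2.1.
    transitivity (\sum_l pi (v l (tot_out Z l (tot_in Z j z))).2.1) => //.
    rewrite (bigD1 j) // big1 => [|l lj]; first by rewrite tot_out_in; apply: addr0.
    by rewrite tot_out_in_neq 1?eq_sym // !linear0.
  have eE : forall x, e (d x) = theta x + codual_d (e x).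
    apply: (tot_ext (f := (e \o d)%FUN) (g := (theta \+ (codual_d \o e))%FUN)) => j z.
    transitivity (e (d (tot_in Z j z))) => //.
    by rewrite tot_d_in e_in v_dif vS -e_in.
  have := trace_pair_cotrace ir f (lm_id P); rewrite f1.
  have := trace_pair_codual ir d e (lm_id P).
  have -> : trace_pair r e (fun x => lm_id P (d x))
      = trace_pair r theta (lm_id P) + trace_pair r (fun w => codual_d (e w)) (lm_id P).
    rewrite /trace_pair -big_split; apply: eq_bigr => l _.
    transitivity ((theta (gen r l) + codual_d (e (gen r l))) l 1); first by rewrite -eE.
    by rewrite dprodDE functionalsDE.
  move=> /eqP; rewrite -subr_eq0 opprD addrCA subrr addr0 oppr_eq0 => /eqP -> /eqP.
  by rewrite eq_sym oner_eq0.
(* As [f (h u) = 0] whenever [u] commutes with [d], the functional [f (h u)]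
   factors as [q (d u - u d)]; the map dual to [q] is a null-homotopy of
   [theta h], and it lifts to the free cover. *)
pose D (u : linear_map P (tot W)) : linear_map P (tot W) :=
  lm_comp (tot_d W) u - lm_comp u d.
have D_lin : linear D.
  move=> a u u'; apply: linear_map_ext => x.
  transitivity (tot_d W (a%:A *: u x + u' x) - (a%:A *: u (d x) + u' (d x))) => //.
  by rewrite [tot_d W _]linearP opprD addrACA -scalerBr.
have F_lin : linear (fun u : linear_map P (tot W) => f (lm_comp (tot_map h) u)).
  move=> a u u'; rewrite -[RHS]linearP; congr (f _); apply: linear_map_ext => x.
  by apply: (linearP (tot_map h)).
have [|u Du0|q qE] := functional_extension (D := mklin D_lin) (f := mklin F_lin).
- by apply: embeddable_tot; apply: tot_fg.
- apply: f_rad => // x; apply/eqP; rewrite eq_sym -subr_eq0; apply/eqP.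
  exact: (congr1 (fun u : linear_map _ _ => u x) Du0).
pose s : {linear tot W -> N} := cotrace i q.
have sE w : s (tot_d W w) = theta (tot_map h w) + codual_d (s w).
  have qd_lin : linear (fun u : linear_map P (tot W) => q (lm_comp u d)).
    by move=> a u v; rewrite -[RHS]linearP; congr (q _); apply: linear_map_ext.
  rewrite [codual_d _](codual_cotrace ir (t := mklin qd_lin)) //.
  apply: nakayamaP => y x; rewrite dprodDE functionalsDE !cotraceE.
  set u := rank_one i y x w.
  transitivity (q (D u) + q (lm_comp u d)).
    rewrite -linearD; congr (q _); rewrite /D subrK.
    by apply: linear_map_ext => z; apply: esym (linearZ_LR (tot_d W) _ _).
  congr (_ + _); rewrite [LHS]qE; congr (f _).
  by apply: linear_map_ext => z; apply: (linearZ_LR (tot_map h)).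
have [e eE] := tot_projective (X := W) s pi_surj.
have l_lin j : linear (fun w : deg W j => (cmap h j w,
    (e (tot_in W j w), e (tot_in W _ (dif W j w)))) : A j).
  move=> a x y; congr (_, (_, _)); first exact: linearP.
    exact: (linearP (e \o tot_in W j)%FUN).
  exact: (linearP (e \o (tot_in W _ \o dif W j))%FUN).
have l_d j w : mklin (l_lin (ordS j)) (dif W j w) = dif cA j (mklin (l_lin j) w).
  congr (_, (_, _)); first exact: cmap_dif.
  by transitivity (e (tot_in W _ (dif W _ (dif W j w)))) => //; rewrite difK !linear0.
pose l : hom W cA := @mkcmap H m W cA (fun j => mklin (l_lin j)) l_d.
have lS j w : S j (cmap l j w).
  change (pi (e (tot_in W _ (dif W j w)))
    = theta (tot_in Z j (cmap h j w)) + codual_d (pi (e (tot_in W j w)))).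
  by rewrite !eE -tot_d_in sE tot_map_in.
have [h' h'E] := subcx_lift dS fgS projS lS.
by exists h'; rewrite -ccompA h'E; apply: cmapP.
Qed.

End Hereditary.
End NonContractible.

(** * Disk complexes *)

Section Stalks.
Variables (R : nzRingType) (m : nat) (i : 'I_m).
Hypothesis i_fix : ordS i != i.

Local Notation cx := (periodic_complexes (proj R) m).

Section Source.
Variable P : lmodType R.
Hypotheses (fgP : finitely_generated P) (projP : projective P).

Definition spread_d (j : 'I_m) : {linear P -> P} :=
  if j == i then lm_id P else lm_zero P P.

Lemma spread_dd j x : spread_d (ordS j) (spread_d j x) = 0.
Proof.
rewrite /spread_d; have [->|//] := eqVneq j i; last by case: ifP.
by rewrite (negbTE i_fix).
Qed.

(** The complex with [P] in every degree whose only nonzero differential is the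
  identity in degree [i]: a disk and some stalks. Having the same module in all
  degrees makes its maps easy to describe. *)
Definition spread : cx := mkcx (fun _ => fgP) (fun _ => projP) spread_dd.

Lemma spread_dif (x : P) : dif spread i x = x.
Proof. by rewrite [LHS]/(spread_d i x) /spread_d eqxx. Qed.

Lemma spread_map (M : cx) (s : {linear P -> deg M i}) :
  exists f : hom spread M, (forall x : P, cmap f i x = s x) /\
    forall j (x : P), j != i -> j != ordS i -> cmap f j x = 0.
Proof.
pose y := dfwith (fun j => \0 : {linear P -> deg M j}) s.
have y_i x : y i x = s x by rewrite /y dfwith_in.
have y_neq j x : j != i -> y j x = 0.
  by move=> ji; rewrite /y dfwith_out // eq_sym.
have [y' y'E] := @ordS_family m (fun j => {linear P -> deg M j})
  (fun j => dif M j \o y j)%FUN.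
have y'_neq j x : j != ordS i -> y' j x = 0.
  move: j x; apply: ordS_ind => j x ji.
  by rewrite y'E /= y_neq ?linear0 //; apply: contraNneq ji => ->.
have y'_dif j x : dif M j (y' j x) = 0.
  by move: j x; apply: ordS_ind => j x; rewrite y'E /= difK.
have fd j x : (y (ordS j) \+ y' (ordS j))%FUN (dif spread j x)
    = dif M j ((y j \+ y' j)%FUN x).
  rewrite [dif spread j x]/(spread_d j x) /= linearD y'_dif addr0 y'E /= /spread_d.
  have [->|ji] := eqVneq j i; first by rewrite y_neq ?add0r.
  by rewrite /= (y_neq j) // !linear0 addr0.
exists (@mkcmap R m spread M (fun j => y j \+ y' j)%FUN fd); split=> [x|j x ji jSi].
  by rewrite mkcmapE /= y_i y'_neq ?addr0 // eq_sym.
by rewrite mkcmapE /= y_neq // y'_neq ?addr0.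
Qed.

End Source.

(** The elements of [M] in degree [i] are the values at [1] of maps from [spread]
  of the regular module to [M]. *)
Lemma mono_injective (M Z : cx) (g : hom M Z) : mono g -> injective (cmap g i).
Proof.
move=> g_mono x x' gxx'; apply/eqP; rewrite -subr_eq0; apply/eqP.
have gx0 : cmap g i (x - x') = 0 by rewrite linearB gxx' subrr.
have [f [f_i f_neq]] := spread_map (@finitely_generated_regular R)
  (@projective_regular R) (scale_map (x - x')).
suff f0 : f = 0.
  by have := f_i 1; rewrite f0 cmap0 /= scale1r.
apply: g_mono; rewrite ccompm0; apply: cmapP => j a; rewrite cmap_comp cmap0.
have gf_i b : cmap g i (cmap f i b) = 0.
  by rewrite f_i /= linearZ_LR gx0 scaler0.
have [ji|ji] := eqVneq j i; first by case: _ / (esym ji) a => a; apply: gf_i.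
have [jSi|jSi] := eqVneq j (ordS i); last by rewrite f_neq ?linear0.
case: _ / (esym jSi) a => a.
rewrite -[a](spread_dif (@finitely_generated_regular R) (@projective_regular R)).
by rewrite !cmap_dif gf_i linear0.
Qed.

(** ** The disk on an indecomposable projective *)

Section Disk.
Variable P : lmodType R.
Hypotheses (fgP : finitely_generated P) (projP : projective P).

Definition disk_support (j : 'I_m) := (j == i) || (j == ordS i).

Definition disk_pred (j : 'I_m) (x : deg (spread fgP projP) j) :=
  disk_support j \/ x = 0.

Lemma disk_sub j : is_submodule (@disk_pred j).
Proof.
split=> [|a x y]; first by right.
by case=> [sj _|->]; [left | case=> [sj|->]; [left | right; rewrite scaler0 addr0]].
Qed.

Lemma disk_dif j x : @disk_pred j x -> disk_pred (dif (spread fgP projP) j x).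
Proof.
move=> _; have [->|ji] := eqVneq j i; first by left; rewrite /disk_support eqxx orbT.
by right; rewrite [LHS]/(spread_d P j x) /spread_d (negbTE ji).
Qed.

Definition disk_retraction (j : 'I_m) : {linear P -> P} :=
  if disk_support j then lm_id P else lm_zero P P.

Lemma disk_retractionP j x : disk_pred (disk_retraction j x : deg (spread fgP projP) j).
Proof.
rewrite /disk_retraction; case: (boolP (disk_support j)) => sj; first by left.
by right.
Qed.

Lemma disk_retractionK j x : @disk_pred j x -> disk_retraction j x = x.
Proof. by rewrite /disk_retraction; case=> [->//|->]; rewrite linear0. Qed.

Definition disk : cx := subcx disk_dif
  (fun j => retract_submod_fg (disk_sub j) (@disk_retractionP j) (@disk_retractionK j) fgP)
  (fun j => @retract_submod_projective _ _ _ (disk_sub j) _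
     (@disk_retractionP j) (@disk_retractionK j) projP).

Definition disk_incl : hom disk (spread fgP projP) := subcx_incl _ _ _.

Definition disk_val : {linear deg disk i -> P} := cmap disk_incl i.

Lemma disk_val_inj : injective disk_val.
Proof. exact: subcx_incl_inj. Qed.

Lemma disk_val_surj (x : P) : exists y, disk_val y = x.
Proof. by apply: subcx_in; left; rewrite /disk_support eqxx. Qed.

(** The differential of the disk in degree [i] is onto, and the other degrees
  vanish. *)
Lemma disk_map_eq (M : cx) (f g : hom disk M) :
  (forall x, cmap f i x = cmap g i x) -> f = g.
Proof.
move=> fg; apply: cmapP => j x.
have [ji|ji] := eqVneq j i; first by case: _ / (esym ji) x => x; apply: fg.
have [jSi|jSi] := eqVneq j (ordS i).
  case: _ / (esym jSi) x => x.
  have [y yx] := disk_val_surj (cmap disk_incl (ordS i) x).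
  have -> : x = dif disk i y.
    apply: (@subcx_incl_inj _ _ _ _ disk_sub disk_dif); rewrite cmap_dif.
    by rewrite -/disk_incl [cmap disk_incl i y]yx spread_dif.
  by rewrite !cmap_dif fg.
have -> : x = 0.
  apply: (@subcx_incl_inj _ _ _ _ disk_sub disk_dif); rewrite linear0.
  have := @subcx_inclP _ _ _ _ disk_sub disk_dif
    (fun j => retract_submod_fg (disk_sub j) (@disk_retractionP j) (@disk_retractionK j) fgP)
    (fun j => @retract_submod_projective _ _ _ (disk_sub j) _
     (@disk_retractionP j) (@disk_retractionK j) projP) j x.
  by case=> //; rewrite /disk_support (negbTE ji) (negbTE jSi).
by rewrite !linear0.
Qed.

Lemma disk_split_epi (M : cx) (g : hom M disk) :
  (forall x, exists y, cmap g i y = x) -> split_epi g.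
Proof.
move=> g_surj.
have [t tK] := projective_section (@deg_projective _ _ disk i) g_surj.
have [v vK] := projective_section projP disk_val_surj.
have [f [f_i _]] := spread_map fgP projP (t \o v)%FUN.
exists (f \o disk_incl); apply: disk_map_eq => x.
rewrite cmap_comp [cmap (f \o _) i x]f_i; transitivity (v (disk_val x)); first exact: tK.
by apply: disk_val_inj; rewrite vK.
Qed.

Definition indecomposable_module (Q : lmodType R) := (exists x : Q, x <> 0) /\
  forall e : {linear Q -> Q}, (forall x, e (e x) = e x) ->
    (forall x, e x = 0) \/ (forall x, e x = x).

Hypothesis indP : indecomposable_module P.

Lemma disk_indecomposable : indecomposable disk.
Proof.
split=> [K0|A B [f [g [r [s [rf gs gf rs frsg]]]]]].
  have [x x0] := indP.1; have [y yx] := disk_val_surj x.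
  by apply: x0; rewrite -yx -[y](cmap_id (X := disk)) K0 cmap0 linear0.
have [v vK] := projective_section projP disk_val_surj.
have vK' y : v (disk_val y) = y by apply: disk_val_inj; rewrite vK.
have fr_idem : (f \o r) \o (f \o r) = f \o r.
  by rewrite -ccompA (ccompA r) rf ccomp1m.
pose fr := f \o r.
have frK y : cmap fr i (cmap fr i y) = cmap fr i y by rewrite -cmap_comp fr_idem.
have [x|e0|e1] := indP.2 (disk_val \o (cmap fr i \o v))%FUN.
- transitivity (disk_val (cmap fr i (v (disk_val (cmap fr i (v x)))))) => //.
  by rewrite vK' frK.
- left; have fr0 : f \o r = 0.
    apply: disk_map_eq => x; rewrite cmap0; apply: disk_val_inj.
    by rewrite linear0 -[x]vK'; apply: e0.
  have f0 : f = 0 by rewrite -[LHS]ccompm1 -rf ccompA fr0 ccomp0m.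
  by rewrite /zero_object -rf f0 ccompm0.
right; have fr1 : f \o r = idm disk.
  apply: disk_map_eq => x; rewrite cmap_id; apply: disk_val_inj.
  by rewrite -[x in LHS]vK' -[RHS]e1.
have sg0 : s \o g = 0 by apply: (addrI (f \o r)); rewrite addr0 frsg fr1.
have s0 : s = 0 by rewrite -[LHS]ccompm1 -gs ccompA sg0 ccomp0m.
by rewrite /zero_object -gs s0 ccompm0.
Qed.

(** No almost split sequence ends in a disk, because conflations ending there
  split. In degree [i], a sink monomorphism is therefore the inclusion of the
  largest proper submodule. *)
Lemma disk_radical :
  (forall Z : cx, indecomposable Z -> pseudo_projective Z \/
    exists (X Y : cx) (f : hom X Y) (g : hom Y Z),
      almost_split_sequence (@degreewise_split (proj R) m) f g) ->
  exists (M : lmodType R) (g : {linear M -> P}),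
    [/\ projective M, injective g, exists x, ~ exists y, g y = x &
        forall x, (exists z, forall a, a *: x <> z) -> exists y, g y = x].
Proof.
move=> /(_ _ disk_indecomposable) [[M [g [[_ [gN g_ras]] g_mono]]]|]; last first.
  move=> [X [Y [f [g [fg _ [_ [gN _]]]]]]]; case: gN; apply: disk_split_epi => x.
  have [r [s [_ gs _ _ _]]] := fg i; exists ((s : linear_map _ _) x).
  exact: (congr1 (fun u : linear_map _ _ => u x) gs).
exists (deg M i), (disk_val \o cmap g i)%FUN; split.
- exact: deg_projective.
- by move=> x y /disk_val_inj /(mono_injective g_mono).
- apply: contrapT => all; apply: gN; apply: disk_split_epi => x.
  apply: contrapT => gx; apply: all; exists (disk_val x) => -[y /disk_val_inj yx].
  by apply: gx; exists y.
- move=> x [z zx]; have [x' x'x] := disk_val_surj x.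
  have [f [f_i _]] := spread_map (@finitely_generated_regular R)
    (@projective_regular R) (scale_map x').
  have fN : ~ split_epi f.
    case=> s fs; have [z' z'z] := disk_val_surj z; case: (zx (cmap s i z')).
    rewrite -z'z -x'x -linearZ_LR; congr (disk_val _).
    by rewrite -[RHS](cmap_id (X := disk)) -fs cmap_comp [RHS]f_i.
  have [h gh] := g_ras _ _ fN; exists (cmap h i (1 : R^o)).
  rewrite -x'x /=; congr (disk_val _).
  by rewrite -[LHS]cmap_comp gh [LHS]f_i /= scale1r.
Qed.

End Disk.
End Stalks.

(** * From radicals of projectives to left ideals *)

Lemma min_nat (P : nat -> Prop) :
  (exists n, P n) -> exists2 n, P n & forall n', P n' -> (n <= n')%N.
Proof.
move=> [n Pn]; have exP : exists n, `[< P n >] by exists n; apply/asboolP.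
by case: (ex_minnP exP) => n0 /asboolP Pn0 n0_min; exists n0 => // n' /asboolP /n0_min.
Qed.

Lemma factor_through_injective (R : nzRingType) (A N Q : lmodType R)
    (j : {linear N -> Q}) (f : {linear A -> Q}) :
  injective j -> (forall a, exists x, j x = f a) ->
  exists g : {linear A -> N}, forall a, j (g a) = f a.
Proof.
move=> j_inj jf; have [g gE] := choice jf.
have g_lin : linear g by move=> a x y; apply: j_inj; rewrite linearP !gE linearP.
by exists (mklin g_lin).
Qed.

Section LeftIdeals.
Variables (k : fieldType) (H : falgType k).

(** The last two clauses say that the image of [g] is the largest proper submodule,
  that is, the radical of [P]. *)
Definition projective_radicals := forall P : lmodType H,
  finitely_generated P -> projective P -> indecomposable_module P ->
  exists (M : lmodType H) (g : {linear M -> P}),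
    [/\ projective M, injective g, exists x, ~ exists y, g y = x &
        forall x, (exists z, forall a, a *: x <> z) -> exists y, g y = x].

Hypothesis radH : projective_radicals.

Section MaximalSubmodule.
Variables (Q N : lmodType H) (j : {linear N -> Q}).
Hypotheses (fgQ : finitely_generated Q) (projQ : projective Q) (j_inj : injective j).
Let S q := exists x, j x = q.
Hypotheses (j_proper : exists q, ~ S q)
  (j_maximal : forall q q', ~ S q -> exists a x, q' = a *: q + j x).

Let subS : is_submodule S.
Proof.
split; first by exists 0; rewrite linear0.
by move=> a _ _ [x <-] [y <-]; exists (a *: x + y); rewrite linearP.
Qed.

(** Take a direct summand of least dimension among those not contained in [S]: if
  it is a sum of two summands, one of these is not contained in [S] either. *)
Lemma minimal_summand :
  exists (P : lmodType H) (v : {linear P -> Q}) (r : {linear Q -> P}),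
  [/\ finitely_generated P, projective P, cancel v r, indecomposable_module P &
      exists x, ~ S (v x)].
Proof.
have [n [i [q iq]]] := fg_projective_retract fgQ projQ.
have im_vspace (e : {linear Q -> Q}) : exists U : {vspace free_space H n},
    forall y, y \in U <-> exists x, y = i (e x).
  apply: subspace_vspace; split; first by exists 0; rewrite !linear0.
  move=> c _ _ [x ->] [y ->]; exists (c%:A *: x + y).
  by rewrite !linearP free_spaceZ.
pose good (e : {linear Q -> Q}) := (forall x, e (e x) = e x) /\ exists x, ~ S (e x).
have [|d [e [U [[ee [x0 ex0]] UE dimU]]] d_min] := @min_nat (fun d =>
    exists (e : {linear Q -> Q}) (U : {vspace free_space H n}),
    [/\ good e, forall y, y \in U <-> exists x, y = i (e x) & \dim U = d]).
  have [U UE] := im_vspace idfun.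
  exists (\dim U), idfun, U; split=> //; split=> //.
have subP : is_submodule (fun x => e x = x).
  split=> [|a x y xE yE]; first exact: linear0.
  by rewrite linearP xE yE.
have eK x : e x = x -> e x = x by [].
pose P := submod subP; pose v : {linear P -> Q} := submod_val subP.
pose r : {linear Q -> P} := submod_lift subP ee.
have vr x : v (r x) = e x by [].
have rv x : r (v x) = x.
  by apply: submod_val_inj; rewrite submod_liftE; exact: (@submod_valP _ _ _ subP x).
have idem1 (f : {linear P -> P}) : (forall x, f (f x) = f x) ->
    (exists x, ~ S (v (f (r x)))) -> forall x, f x = x.
  move=> ff fS x.
  pose e' : {linear Q -> Q} := (v \o (f \o r))%FUN.
  have [U' U'E] := im_vspace e'.
  have sU'U : (U' <= U)%VS.
    apply/subvP => y /U'E [z ->]; apply/UE; exists (v (f (r z))).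
    by rewrite -vr rv.
  have U'U : (U' == U).
    rewrite eqEdim sU'U dimU; apply: d_min; exists e', U'; split=> //.
    split=> // z; transitivity (v (f (r (v (f (r z)))))) => //.
    by rewrite rv ff.
  have : i (v x) \in U by apply/UE; exists (v x); rewrite -vr rv.
  rewrite -(eqP U'U) => /U'E [z /(can_inj iq) /submod_val_inj ->].
  exact: ff.
exists P, v, r; split=> //.
- exact: retract_submod_fg eK fgQ.
- exact: (@retract_submod_projective _ _ _ _ e).
- split.
    exists (r x0) => rx0; apply: ex0; rewrite -vr rx0 linear0.
    exact: subS.1.
  move=> f ff; have [fS|fS] := pselect (exists x, ~ S (v (f (r x)))).
    by right; apply: idem1.
  have g_lin : linear (fun x => x - f x).
    by move=> a x y; rewrite linearP opprD addrACA scalerBr.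
  have gg x : mklin g_lin (mklin g_lin x) = mklin g_lin x.
    by rewrite /= linearB ff subrr subr0.
  have g1 : forall x, mklin g_lin x = x.
    apply: idem1 gg _; exists x0 => /= Sg; apply: ex0.
    rewrite -vr -[r x0](subrK (f (r x0))) linearD.
    apply: is_submoduleD => //; apply: contrapT => Sf.
    by apply: fS; exists x0.
  by left=> x; have := g1 x => /= /eqP; rewrite subr_eq addrC -subr_eq subrr => /eqP.
- by exists (r x0).
Qed.

(** For the summand [P] of the preceding lemma, [P] and [N] together span [Q], by
  maximality. So [N] maps onto the complement [Q / P], with kernel the
  intersection of [P] and [N], which is the radical of [P]. *)
Lemma maximal_submodule_projective : projective N.
Proof.
have [P [v [r [fgP projP rv indP [p0 vp0]]]]] := minimal_summand.
have [M [g [projM g_inj [x1 x1g] g_max]]] := radH fgP projP indP.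
have Sg p : S (v p) -> exists y, g y = p.
  move=> Svp; apply: g_max; exists p0 => a ap; apply: vp0.
  by rewrite -ap linearZ; have := subS.2 a _ _ Svp subS.1; rewrite addr0.
have gS y : S (v (g y)).
  apply: contrapT => Sgy; apply: x1g.
  have [a [x xE]] := j_maximal (v x1) Sgy.
  have [|z zE] := Sg (x1 - a *: g y).
    by exists x; rewrite linearB linearZ xE addrC addKr.
  by exists (z + a *: y); rewrite linearD linearZ zE subrK.
pose e : {linear Q -> Q} := (v \o r)%FUN.
have ee x : e (e x) = e x by rewrite /= rv.
have subK : is_submodule (fun x => e x = 0).
  split=> [|a x y x0 y0]; first exact: linear0.
  by rewrite linearP x0 y0 scaler0 addr0.
have c_lin : linear (fun x => x - e x).
  by move=> a x y; rewrite [e _]linearP opprD addrACA scalerBr.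
have cK x : e (mklin c_lin x) = 0 by rewrite [e _]linearB ee subrr.
have projK : projective (submod subK).
  apply: (@retract_submod_projective _ _ _ _ (mklin c_lin)) => // x x0.
  by transitivity (x - e x) => //; rewrite (x0 : e x = 0) subr0.
pose c : {linear N -> submod subK} := (submod_lift subK cK \o j)%FUN.
have cE x : submod_val subK (c x) = j x - e (j x) by [].
have c_surj q : exists x, c x = q.
  have [a [x xE]] := j_maximal (submod_val subK q) vp0.
  have q0 : e (submod_val subK q) = 0 := submod_valP q.
  exists x; apply: submod_val_inj; rewrite cE.
  have -> : j x = submod_val subK q - a *: v p0 by rewrite xE addrC addKr.
  by rewrite [e _]linearB q0 sub0r [e _]linearZ /= rv opprK subrK.
have [t tK] := projective_section projK c_surj.
have h_lin : linear (fun x => j (x - t (c x))).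
  by move=> a x y; rewrite [c _]linearP [t _]linearP opprD addrACA -scalerBr linearP.
have [h hE] : exists h : {linear N -> M}, forall x, v (g (h x)) = mklin h_lin x.
  apply: (factor_through_injective (j := (v \o g)%FUN) (f := mklin h_lin)).
    by move=> x y /(can_inj rv) /g_inj.
  move=> x; have c0 : c (x - t (c x)) = 0 by rewrite linearB tK subrr.
  have ej : j (x - t (c x)) = v (r (j (x - t (c x)))).
    by apply/eqP; rewrite -subr_eq0 -[X in X == _]cE c0 linear0.
  have [|y yE] := Sg (r (j (x - t (c x)))); first by rewrite -ej; eexists.
  by exists y; rewrite /= yE -ej.
have [w wE] : exists w : {linear M -> N}, forall y, j (w y) = v (g y).
  exact: (factor_through_injective (f := (v \o g)%FUN)).
pose i x : (M * submod subK)%type := (h x, c x).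
have i_lin : linear i by move=> a x y; congr (_, _); rewrite linearP.
pose s (z : (M * submod subK)%type) := w z.1 + t z.2.
have s_lin : linear s by move=> a x y; rewrite /s !linearP scalerDr addrACA.
apply: (projective_retract (i := mklin i_lin) (r := mklin s_lin)).
  move=> x; apply: j_inj; rewrite /= /s linearD wE hE /=.
  by rewrite -linearD subrK.
exact: projective_pair.
Qed.

End MaximalSubmodule.

Lemma left_ideal_vspace (T : H^o -> Prop) : is_submodule T ->
  exists U : {vspace H}, forall x, x \in U <-> T x.
Proof.
move=> [T0 TD]; apply: subspace_vspace; split=> // c x y Tx Ty.
have := TD c%:A x y Tx Ty.
by have -> : (c%:A : H) *: (x : H^o) = c *: x :> H by exact: mulr_algl.
Qed.

Lemma left_ideal_ext (T T' : H^o -> Prop) (U U' : {vspace H}) :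
  (forall x, x \in U <-> T x) -> (forall x, x \in U' <-> T' x) ->
  (forall x, T' x -> T x) -> (\dim U <= \dim U')%N -> forall x, T x -> T' x.
Proof.
move=> UT UT' T'T dimUU' x /UT xU; apply/UT'.
have -> : U' = U.
  apply/eqP; rewrite eqEdim dimUU' andbT.
  by apply/subvP => y /UT' /T'T /UT.
by [].
Qed.

(** Among the projective left ideals containing [I] take one of least dimension,
  [T]. Were it larger than [I], a maximal one among the proper submodules of [T]
  that contain [I] would be projective, and smaller. *)
Lemma left_ideal_projective (I : submodClosed H^o) : projective (submodule I).
Proof.
pose S (x : H^o) := x \in I.
have subS : is_submodule S.
  split; first exact: rpred0.
  by move=> a x y Sx Sy; apply: rpredD => //; apply: rpredZ.
have [|d [T [subT [U [ST projT UT dimU]]]] d_min] := @min_nat (fun d =>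
    exists T (subT : is_submodule T) (U : {vspace H}),
    [/\ forall x, S x -> T x, projective (submod subT),
        forall x, x \in U <-> T x & \dim U = d]).
  have subT : is_submodule (fun _ : H^o => True) by [].
  have [U UT] := left_ideal_vspace subT.
  exists (\dim U), (fun=> True), subT, U; split=> //.
  apply: (@retract_submod_projective _ _ _ subT idfun) => //.
  exact: projective_regular.
have [TS|TnS] := pselect (forall x, T x -> S x).
  have iT (x : submodule I) : T (submodule_val x) by apply: ST; apply: submodule_valP.
  have val_lin : linear (fun x : submodule I => submodule_val x : H^o) by [].
  have rS (x : submod subT) : S (submod_val subT x) by apply: TS; apply: submod_valP.
  have r_lin : linear (fun x : submod subT => Submodule (rS x) : submodule I).
    by move=> a x y; apply: val_inj.
  apply: (projective_retract (i := submod_lift subT (f := mklin val_lin) iT)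
    (r := mklin r_lin)) => // x.
  exact: val_inj.
have [T' [subT' [U' [ST' T'T T'nT U'T' U'_max]]]] : exists T' (subT' : is_submodule T')
    (U' : {vspace H}), [/\ forall x, S x -> T' x, forall x, T' x -> T x,
      exists x, T x /\ ~ T' x, forall x, x \in U' <-> T' x &
      forall T2 (subT2 : is_submodule T2) (U2 : {vspace H}), (forall x, S x -> T2 x) ->
        (forall x, T2 x -> T x) -> (exists x, T x /\ ~ T2 x) ->
        (forall x, x \in U2 <-> T2 x) -> (\dim U2 <= \dim U')%N].
  (* Minimize the codimension [e] in [H]. *)
  have [|e [T' [subT' [U' [ST' T'T T'nT U'T' dimU']]]] e_min] := @min_nat (fun e =>
    exists T' (subT' : is_submodule T') (U' : {vspace H}),
    [/\ forall x, S x -> T' x, forall x, T' x -> T x, exists x, T x /\ ~ T' x,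
      forall x, x \in U' <-> T' x & \dim U' + e = \dim {:H}]%N).
    have [U' U'S] := left_ideal_vspace subS.
    exists (\dim {:H} - \dim U')%N, S, subS, U'; split=> //.
      apply: contrapT => noT; apply: TnS => x Tx; apply: contrapT => Sx.
      by apply: noT; exists x.
    by rewrite subnKC ?dimvS ?subvf.
  exists T', subT', U'; split=> // T2 subT2 U2 ST2 T2T T2nT UT2.
  have U2H : (\dim U2 <= \dim {:H})%N by rewrite dimvS ?subvf.
  rewrite -(leq_add2r e) dimU' -leq_subRL //.
  apply: e_min; exists T2, subT2, U2; split=> //.
  by rewrite subnKC.
have T'P (x : submod subT') : T (submod_val subT' x) by apply: T'T; apply: submod_valP.
pose j : {linear submod subT' -> submod subT} := submod_lift subT T'P.
have j_inj : injective j.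
  by move=> x y /(congr1 (submod_val subT)); rewrite !submod_liftE => /submod_val_inj.
have jP q : (exists x, j x = q) <-> T' (submod_val subT q).
  split=> [[x <-]|T'q]; first exact: (submod_valP x).
  by exists (submod_mk subT' T'q); apply: submod_val_inj.
have fgT : finitely_generated (submod subT).
  apply: finitely_generated_submod; first exact: finitely_generated_regular.
  exact: projective_regular.
have projT' : projective (submod subT').
  apply: (maximal_submodule_projective fgT projT j_inj).
    have [x [Tx T'x]] := T'nT; exists (submod_mk subT Tx).
    by move/jP.
  move=> q q' /jP T'q.
  pose T2 (x : H^o) := exists a y, T' y /\ x = a *: submod_val subT q + y.
  have subT2 : is_submodule T2.
    split; first by exists 0, 0; split; [exact: subT'.1 | rewrite scale0r addr0].
    move=> a _ _ [b [y [T'y ->]]] [b' [y' [T'y' ->]]].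
    exists (a * b + b'), (a *: y + y'); split; first exact: subT'.2.
    by rewrite scalerDl -scalerA scalerDr addrACA.
  have T'T2 x : T' x -> T2 x by move=> T'x; exists 0, x; rewrite scale0r add0r.
  have T2q : T2 (submod_val subT q).
    by exists 1, 0; rewrite scale1r addr0; split=> //; apply: subT'.1.
  have T2T x : T2 x -> T x.
    by move=> [a [y [T'y ->]]]; apply: subT.2; [apply: submod_valP | apply: T'T].
  have [a [y [T'y q'E]]] : T2 (submod_val subT q').
    apply: contrapT => T2q'; have [U2 U2T2] := left_ideal_vspace subT2.
    apply: T'q; apply: (left_ideal_ext U2T2 U'T') => //.
    apply: (U'_max T2 subT2) => // [x Sx|]; first by apply/T'T2/ST'.
    by exists (submod_val subT q'); split=> //; apply: submod_valP.
  exists a, (submod_mk subT' T'y); apply: submod_val_inj.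
  by rewrite q'E linearP submod_liftE submod_mkE.
have [x [Tx []]] := T'nT.
apply: (left_ideal_ext UT U'T') => //; rewrite dimU; apply: d_min.
by exists T', subT', U'.
Qed.

End LeftIdeals.

(** * The left Auslander-Reiten property and heredity *)

Theorem left_AR_of_hereditary (k : fieldType) (H : falgType k) (m : nat) :
  hereditary H -> left_AR_category (periodic_complexes (proj H) m)
    (@degreewise_split (proj H) m).
Proof.
move=> herH; split=> [|Z indZ]; first exact: cx_krull_schmidt.
have [contrZ|ncZ] := pselect (contractible Z); [left | right].
  exact: pseudo_projective_of_contractible.
have locZ := cx_local indZ.
have [Y0 [g0 [g0_ras g0_surj]]] := right_almost_split_ex herH locZ ncZ.
have [Y [g g_sink]] := sink_of_right_almost_split (@cx_idempotents_split _ m)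
  (@cx_stabilizes k H m) (@cx_dim_ex k H m) (@cx_dim_drops k H m) g0_ras.
have g_surj : degreewise_surjective g.
  have [h gh] := g_sink.2.2 _ _ g0_ras.1.
  move=> i z; have [y <-] := g0_surj i z; exists (cmap h i y).
  by rewrite -gh cmap_comp.
have [X [f fg]] := almost_split_of_sink g_surj locZ g_sink.
by exists X, Y, f, g.
Qed.

Theorem hereditary_of_left_AR (k : fieldType) (H : falgType k) (m : nat) :
  (2 <= m)%N -> left_AR_category (periodic_complexes (proj H) m)
    (@degreewise_split (proj H) m) -> hereditary H.
Proof.
move=> m2 [_ AR] I; apply: left_ideal_projective => P fgP projP indP.
have m0 : (0 < m)%N by apply: leq_trans m2.
have i_fix : ordS (Ordinal m0) != Ordinal m0 by rewrite -val_eqE /= modn_small.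
exact: (disk_radical i_fix fgP projP indP AR).
Qed.

Theorem proposition5p4 (k : fieldType) (H : falgType k) (m : nat)
    (hm : (2 <= m)%N) :
  (hereditary H ->
     left_AR_category (periodic_complexes (proj H) m)
       (@degreewise_split (proj H) m)) /\
  ((2 < m)%N ->
     left_AR_category (periodic_complexes (proj H) m)
       (@degreewise_split (proj H) m) -> hereditary H).
Proof.
split=> [|m3]; first exact: left_AR_of_hereditary.
exact: hereditary_of_left_AR.
Qed.
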